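(* For any fixed $c\in[0,2)$ there exists a unique function $\theta^{(c)}$ belonging to $\mathscr{C}^{(1,\alpha)}(\mathbb{R};(0,1))$ for all $\alpha\in[0,1)$ such that $$\partial_x^2\theta^{(c)}+c\,\partial_x\theta^{(c)}+\mu(x)\theta^{(c)}-(\theta^{(c)})^3=0\quad\text{on }\mathbb{R}\text{ in the sense of distributions},$$ $$0<\theta^{(c)}(x)<1,\qquad \lim_{x\to-\infty}\theta^{(c)}(x)=1,\qquad \lim_{x\to+\infty}\theta^{(c)}(x)=0.$$ The convergence to both limits takes place at an exponential rate. Furthermore $\theta^{(c)}$ is strictly positive and $(\theta^{(c)})'(x)<0$ for all $x\in\mathbb{R}$. If $c>2$, no solution of this problem exists.
   Context: $\mu:\mathbb{R}\to\mathbb{R}$ is the step function $\mu(x)=1$ for $x<0$ and $\mu(x)=-1$ for $x>0$. $\mathscr{C}^{(1,\alpha)}(X;Y)$ denotes the $\alpha$-Hölder continuously differentiable functions from $X$ to $Y$. *)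

(* Defs.v *)
From Stdlib Require Import Reals.
From Coquelicot Require Import Coquelicot.
Open Scope R_scope.

(* The value at 0 is left free, as it has no influence on the equation. *)
Definition is_step (mu : R -> R) : Prop :=
  (forall x, x < 0 -> mu x = 1) /\ (forall x, 0 < x -> mu x = -1).

(* C^(1,alpha)(R; Y). The restriction to x <> y is needed because
   Rpower 0 alpha = 1 in Stdlib. *)
Definition C1_holder (alpha : R) (Y : R -> Prop) (f : R -> R) : Prop :=
  (forall x, Y (f x)) /\
  (forall x, ex_derive f x) /\
  (forall x, continuous (Derive f) x) /\
  (exists K, forall x y, x <> y ->
     Rabs (Derive f x - Derive f y) <= K * Rpower (Rabs (x - y)) alpha).

Definition test_function (a b : R) (phi : R -> R) : Prop :=
  (forall n x, ex_derive_n phi n x) /\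
  (forall x, x < a \/ b < x -> phi x = 0).

(* theta'' + c theta' + mu theta - theta^3 = 0 on R as a distribution: all
   derivatives are moved to the test function. As phi is supported in [a, b],
   the integral over R is the integral over [a, b]. *)
Definition distributional_solution (mu : R -> R) (c : R) (theta : R -> R) :
    Prop :=
  forall a b phi, a <= b -> test_function a b phi ->
    is_RInt (fun x => theta x * Derive_n phi 2 x
                      - c * (theta x * Derive phi x)
                      + (mu x * theta x - theta x ^ 3) * phi x) a b 0.

Definition front (mu : R -> R) (c : R) (theta : R -> R) : Prop :=
  (forall alpha, 0 <= alpha < 1 ->
     C1_holder alpha (fun y => 0 < y < 1) theta) /\
  distributional_solution mu c theta /\
  (forall x, 0 < theta x < 1) /\
  is_lim theta m_infty 1 /\
  is_lim theta p_infty 0.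

Definition exp_rate_m_infty (f : R -> R) (l : R) : Prop :=
  exists C k x0, 0 < k /\
    forall x, x <= x0 -> Rabs (f x - l) <= C * exp (k * x).

Definition exp_rate_p_infty (f : R -> R) (l : R) : Prop :=
  exists C k x0, 0 < k /\
    forall x, x0 <= x -> Rabs (f x - l) <= C * exp (- k * x).

(* Main.v *)
Require Import Defs.
From Stdlib Require Import Reals Lra Lia Psatz.
From Stdlib Require Import FunctionalExtensionality Classical.
From Coquelicot Require Import Coquelicot.
Open Scope R_scope.

(**
  By the lemma of du Bois-Reymond a front is a [C^1] function [u] solving the
  equation classically off the origin. The flux [e^(c x) u'] is then decreasing
  on the left and increasing on the right half-line, which forces [u' < 0] and
  makes the flux vanish at [-oo] and stay bounded at [+oo]. Two fronts are
  compared as in the Brezis-Oswald argument: their weighted Wronskian [W] has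
  derivative [e^(c x) u1 u2 (u1^2 - u2^2)] and tends to 0 at both ends, which is
  impossible if [u1 > u2] somewhere. First-order differential inequalities for
  [u' + k u] give the exponential rates, and for [c > 2] incompatible bounds on
  [u' / u] at the origin.

  For existence, [K = 2 (2 + c)] makes [(K + mu) u - u^3] nondecreasing in
  [0 <= u <= 1], so that a front is a fixed point of the order-preserving map
  [f |-> (K - c D - D^2)^-1 ((K + mu) f - f^3)]. The supremum of all Lipschitz
  subsolutions is such a fixed point. It is nonincreasing because its
  translates to the left are subsolutions, and it is nonzero because for [c < 2]
  there is a small subsolution [e^(-c x / 2) (1 - y^2)_+^2] supported in
  [x < 0], with [y] a rescaled centered coordinate.
*)

(** The weight e^(c x) puts the equation in divergence form, (e^(c x) u')' = - e^(c x) (mu u - u^3).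
    For two fronts the terms in c and [mu] cancel in W', and what remains has the sign of u1 - u2
    because (mu u - u^3) / u = mu - u^2 is strictly decreasing in u > 0. The jump of [mu] denies u a
    second derivative at 0, so the calculus is done off 0 and glued there by continuity.

    A supremum of subsolutions avoids passing to the limit in an iteration; the Lipschitz bound,
    shared by all images of the map, keeps it continuous, so that the map applies to it.

    The threshold 2 comes from the linearisation at 0 on the left: with u = e^(- c x / 2) w, the
    expression u'' + c u' + u becomes e^(- c x / 2) (w'' + (1 - c^2 / 4) w). For c < 2 the
    coefficient is positive and a wide bump w gives a subsolution; for c > 2 it is negative and
    makes e^(c x / 2) u convex on the left half-line. *)

Ltac ex_derives :=
  repeat match goal with
    | |- _ /\ _ => split
    | |- ex_derive _ _ => eexists; eassumption
    | |- True => exact I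
    end.

(** * Monotonicity and first crossings *)

Lemma mean_value (f df : R -> R) (a b : R) :
  a < b ->
  (forall x, a < x < b -> is_derive f x (df x)) ->
  (forall x, a <= x <= b -> continuous f x) ->
  exists x, a < x < b /\ f b - f a = df x * (b - a).
Proof.
  intros hab hd hc.
  assert (pr1 : forall x, a < x < b -> derivable_pt f x).
  { intros x hx. exists (df x). apply is_derive_Reals, hd, hx. }
  assert (pr2 : forall x, a < x < b -> derivable_pt id x)
    by (intros; apply derivable_pt_id).
  destruct (MVT f id a b pr1 pr2 hab) as [x [hx e]].
  - intros x hx. apply continuity_pt_filterlim, hc, hx.
  - intros x _. apply derivable_continuous_pt, derivable_pt_id.
  - exists x. split; [exact hx|].
    rewrite (derive_pt_eq_0 f x (df x)) in e
      by (apply is_derive_Reals, hd, hx).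
    rewrite (derive_pt_eq_0 id x 1) in e by apply derivable_pt_lim_id.
    unfold id in e. lra.
Qed.

Lemma nondecreasing_of_derive (f df : R -> R) (a b : R) :
  a <= b ->
  (forall x, a < x < b -> is_derive f x (df x)) ->
  (forall x, continuous f x) ->
  (forall x, a < x < b -> 0 <= df x) ->
  f a <= f b.
Proof.
  intros hab hd hc h. destruct (Req_dec a b) as [->|hne]; [lra|].
  destruct (mean_value f df a b) as [x [hx e]]; auto; [lra|].
  specialize (h x hx). nra.
Qed.

Lemma increasing_of_derive (f df : R -> R) (a b : R) :
  a < b ->
  (forall x, a < x < b -> is_derive f x (df x)) ->
  (forall x, continuous f x) ->
  (forall x, a < x < b -> 0 < df x) ->
  f a < f b.
Proof.
  intros hab hd hc h.
  destruct (mean_value f df a b) as [x [hx e]]; auto.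
  specialize (h x hx). nra.
Qed.

Lemma nonincreasing_of_derive (f df : R -> R) (a b : R) :
  a <= b ->
  (forall x, a < x < b -> is_derive f x (df x)) ->
  (forall x, continuous f x) ->
  (forall x, a < x < b -> df x <= 0) ->
  f b <= f a.
Proof.
  intros hab hd hc h. destruct (Req_dec a b) as [->|hne]; [lra|].
  destruct (mean_value f df a b) as [x [hx e]]; auto; [lra|].
  specialize (h x hx). nra.
Qed.

Lemma decreasing_of_derive (f df : R -> R) (a b : R) :
  a < b ->
  (forall x, a < x < b -> is_derive f x (df x)) ->
  (forall x, continuous f x) ->
  (forall x, a < x < b -> df x < 0) ->
  f b < f a.
Proof.
  intros hab hd hc h.
  destruct (mean_value f df a b) as [x [hx e]]; auto.
  specialize (h x hx). nra.
Qed.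

Lemma continuous_of_is_derive (f : R -> R) (x l : R) :
  is_derive f x l -> continuous f x.
Proof.
  intros h. apply (ex_derive_continuous (V := R_NormedModule)).
  exists l. exact h.
Qed.

Lemma continuous_exp_lin (k x : R) : continuous (fun t => exp (k * t)) x.
Proof.
  apply (continuous_of_is_derive _ _ (k * exp (k * x))).
  auto_derive; auto; ring.
Qed.

(** The point z is the supremum of the points up to which [f] stays positive; by continuity [f z]
    cannot be positive, or positivity would extend past z. *)
Lemma first_nonpositive (f : R -> R) (a b : R) :
  a < b -> (forall x, continuous f x) -> 0 < f a -> f b <= 0 ->
  exists z, a < z <= b /\ f z <= 0 /\ forall t, a <= t < z -> 0 < f t.
Proof.
  intros hab hc ha hb.
  set (E := fun t => a <= t <= b /\ forall s, a <= s <= t -> 0 < f s).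
  assert (Ea : E a).
  { split; [lra|]. intros s hs. replace s with a by lra. exact ha. }
  destruct (completeness E) as [z [hz1 hz2]].
  { exists b. intros t [ht _]. lra. }
  { exists a. exact Ea. }
  assert (haz : a <= z) by (apply hz1, Ea).
  assert (hzb : z <= b) by (apply hz2; intros t [ht _]; lra).
  assert (hlt : forall t, a <= t < z -> 0 < f t).
  { intros t ht. apply NNPP. intros hn.
    assert (z <= t); [|lra]. apply hz2. intros s [hs1 hs2].
    destruct (Rle_dec s t) as [h|h]; [exact h|].
    exfalso. apply hn, hs2. lra. }
  assert (hfz : f z <= 0).
  { apply Rnot_lt_le. intros hp.
    assert (zb : z < b).
    { destruct (Req_dec z b) as [e|e]; [|lra]. rewrite e in hp. lra. }
    destruct (hc z (fun y => 0 < y)) as [eps he].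
    { apply open_gt. exact hp. }
    assert (E (Rmin b (z + eps / 2))).
    { pose proof (cond_pos eps) as hep.
      split.
      { split; [apply Rmin_glb; lra|apply Rmin_l]. }
      intros s hs. destruct (Rlt_dec s z) as [h|h]; [apply hlt; lra|].
      apply he. pose proof (Rmin_r b (z + eps / 2)).
      change (Rabs (s - z) < eps). rewrite Rabs_right; lra. }
    apply hz1 in H. pose proof (cond_pos eps).
    revert H. unfold Rmin. destruct (Rle_dec b (z + eps / 2)); lra. }
  exists z. repeat split; auto.
  destruct (Req_dec a z) as [e|e]; [|lra]. rewrite <- e in hfz. lra.
Qed.

Lemma last_nonpositive (f : R -> R) (a b : R) :
  a < b -> (forall x, continuous f x) -> f a <= 0 -> 0 < f b ->
  exists z, a <= z < b /\ f z <= 0 /\ forall t, z < t <= b -> 0 < f t.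
Proof.
  intros hab hc ha hb.
  destruct (first_nonpositive (fun x => f (- x)) (- b) (- a))
    as [z [hz1 [hz2 hz3]]].
  - lra.
  - intros x. apply (continuous_comp Ropp f); [|apply hc].
    apply (continuous_opp (V := R_NormedModule)), continuous_id.
  - rewrite Ropp_involutive. exact hb.
  - rewrite Ropp_involutive. exact ha.
  - exists (- z). split; [lra|]. split; [exact hz2|].
    intros t ht. rewrite <- (Ropp_involutive t). apply hz3. lra.
Qed.

(** * Classical fronts *)

(** The two half-line equations are matched at 0 by the continuity of [du]; its derivative there may
    jump. *)
Definition classical_solution (c : R) (u du : R -> R) : Prop :=
  (forall x, is_derive u x (du x)) /\
  (forall x, continuous du x) /\
  (forall x, x < 0 -> is_derive du x (- c * du x - u x + u x ^ 3)) /\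
  (forall x, 0 < x -> is_derive du x (- c * du x + u x + u x ^ 3)).

Definition classical_front (c : R) (u du : R -> R) : Prop :=
  classical_solution c u du /\
  (forall x, 0 < u x < 1) /\
  is_lim u m_infty 1 /\
  is_lim u p_infty 0.

Lemma is_lim_p_infty_below (f : R -> R) (l e : R) :
  is_lim f p_infty l -> l < e -> exists X, forall x, X < x -> f x < e.
Proof.
  intros h he. apply (h (fun y => y < e)). apply open_lt. exact he.
Qed.

Lemma is_lim_m_infty_above (f : R -> R) (l e : R) :
  is_lim f m_infty l -> e < l -> exists X, forall x, x < X -> e < f x.
Proof.
  intros h he. apply (h (fun y => e < y)). apply open_gt. exact he.
Qed.

Definition flux (c : R) (du : R -> R) (x : R) : R := exp (c * x) * du x.

Section ClassicalFront.

Variables (c : R) (u du : R -> R).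
Hypothesis hc : 0 <= c.
Hypothesis hu : classical_front c u du.

Lemma front_bounds x : 0 < u x < 1.
Proof. apply hu. Qed.

Lemma front_derive x : is_derive u x (du x).
Proof. apply hu. Qed.

Lemma front_derive_continuous x : continuous du x.
Proof. apply hu. Qed.

Lemma front_continuous x : continuous u x.
Proof. apply (continuous_of_is_derive _ _ _ (front_derive x)). Qed.

Lemma flux_continuous x : continuous (flux c du) x.
Proof.
  apply (continuous_mult (K := R_AbsRing) (fun t => exp (c * t)) du).
  - apply continuous_exp_lin.
  - apply front_derive_continuous.
Qed.

Lemma flux_derive_neg x : x < 0 ->
  is_derive (flux c du) x (- (exp (c * x) * (u x * (1 - u x ^ 2)))).
Proof.
  intros hx. assert (h := proj1 (proj2 (proj2 (proj1 hu))) x hx).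
  unfold flux. auto_derive.
  - ex_derives.
  - rewrite (is_derive_unique (fun t : R => du t) _ _ h). ring.
Qed.

Lemma flux_derive_pos x : 0 < x ->
  is_derive (flux c du) x (exp (c * x) * (u x * (1 + u x ^ 2))).
Proof.
  intros hx. assert (h := proj2 (proj2 (proj2 (proj1 hu))) x hx).
  unfold flux. auto_derive.
  - ex_derives.
  - rewrite (is_derive_unique (fun t : R => du t) _ _ h). ring.
Qed.

Lemma flux_decreasing x y : x < y -> y <= 0 -> flux c du y < flux c du x.
Proof.
  intros hxy hy.
  apply (decreasing_of_derive _
    (fun x => - (exp (c * x) * (u x * (1 - u x ^ 2))))); auto.
  - intros t ht. apply flux_derive_neg. lra.
  - apply flux_continuous.
  - intros t ht. pose proof (exp_pos (c * t)). pose proof (front_bounds t).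
    apply Ropp_lt_gt_0_contravar. apply Rmult_lt_0_compat; [lra|].
    apply Rmult_lt_0_compat; nra.
Qed.

Lemma flux_increasing x y : x < y -> 0 <= x -> flux c du x < flux c du y.
Proof.
  intros hxy hy.
  apply (increasing_of_derive _
    (fun x => exp (c * x) * (u x * (1 + u x ^ 2)))); auto.
  - intros t ht. apply flux_derive_pos. lra.
  - apply flux_continuous.
  - intros t ht. pose proof (exp_pos (c * t)). pose proof (front_bounds t).
    apply Rmult_lt_0_compat; [lra|].
    apply Rmult_lt_0_compat; nra.
Qed.

Lemma du_flux x : du x = exp (- c * x) * flux c du x.
Proof.
  unfold flux. rewrite <- Rmult_assoc, <- exp_plus.
  replace (- c * x + c * x) with 0 by ring. rewrite exp_0. ring.
Qed.

Lemma exp_neg_ge_1 x : x <= 0 -> 1 <= exp (- c * x).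
Proof.
  intros hx. pose proof (exp_ineq1_le (- c * x)). nra.
Qed.

Lemma front_increment x y : x < y ->
  exists t, x < t < y /\ u y - u x = du t * (y - x).
Proof.
  intros h. apply mean_value; auto.
  - intros; apply front_derive.
  - intros; apply front_continuous.
Qed.

(** Otherwise the flux is at least some e > 0 on the whole half-line left of x - 1. There e^(- c t)
    >= 1, so u' >= e too, and over a length 1 / e the function would gain at least 1, which the
    bounds 0 < u < 1 forbid. *)
Lemma du_neg_left x : x <= 0 -> du x < 0.
Proof.
  intros hx. apply Rnot_le_lt. intros hd.
  assert (hP : 0 <= flux c du x).
  { unfold flux. pose proof (exp_pos (c * x)). nra. }
  pose proof (flux_decreasing (x - 1) x ltac:(lra) hx) as h1.
  set (e := flux c du (x - 1)) in *.
  assert (he : 0 < / e) by (apply Rinv_0_lt_compat; lra).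
  destruct (front_increment (x - 1 - / e) (x - 1)) as [t [ht e1]]; [lra|].
  assert (hdt : e <= du t).
  { rewrite du_flux. pose proof (exp_neg_ge_1 t ltac:(lra)).
    pose proof (flux_decreasing t (x - 1) ltac:(lra) ltac:(lra)).
    fold e in H0. nra. }
  pose proof (front_bounds (x - 1)). pose proof (front_bounds (x - 1 - / e)).
  assert (e * / e = 1) by (apply Rinv_r; lra). nra.
Qed.

(** Otherwise the flux, being increasing, is positive after x, and u increases away from its limit
    0. *)
Lemma du_neg_right x : 0 < x -> du x < 0.
Proof.
  intros hx. apply Rnot_le_lt. intros hd.
  assert (hP : 0 <= flux c du x).
  { unfold flux. pose proof (exp_pos (c * x)). nra. }
  assert (hmono : forall y, x < y -> u x < u y).
  { intros y hy. apply (increasing_of_derive _ du); auto.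
    - intros; apply front_derive.
    - intros; apply front_continuous.
    - intros t ht. rewrite du_flux.
      pose proof (flux_increasing x t ltac:(lra) ltac:(lra)).
      pose proof (exp_pos (- c * t)). nra. }
  destruct (is_lim_p_infty_below u 0 (u x)) as [X hX].
  - apply hu.
  - apply front_bounds.
  - pose proof (Rmax_l x X). pose proof (Rmax_r x X).
    pose proof (hX (Rmax x X + 1) ltac:(lra)).
    pose proof (hmono (Rmax x X + 1) ltac:(lra)). lra.
Qed.

Lemma du_neg x : du x < 0.
Proof.
  destruct (Rle_dec x 0); [apply du_neg_left|apply du_neg_right]; lra.
Qed.

Lemma flux_neg x : flux c du x < 0.
Proof.
  unfold flux. pose proof (exp_pos (c * x)). pose proof (du_neg x). nra.
Qed.

(** The mean slope on [x, 0] exceeds 1 / x because u varies by less than 1, and the flux at x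
    dominates every slope on that interval. Together with [flux_neg] this is the quantitative form
    of the flux vanishing at -oo. *)
Lemma flux_lower_left x : x < 0 -> / x < flux c du x.
Proof.
  intros hx. destruct (front_increment x 0 hx) as [t [ht e]].
  assert (hd : du t <= flux c du x).
  { rewrite du_flux. pose proof (exp_neg_ge_1 t ltac:(lra)).
    pose proof (flux_decreasing x t ltac:(lra) ltac:(lra)).
    pose proof (flux_neg t). nra. }
  pose proof (front_bounds x). pose proof (front_bounds 0).
  apply Rmult_lt_reg_r with (- x); [lra|].
  replace (/ x * - x) with (-1) by (field; lra). nra.
Qed.

Lemma flux_lower_right x : 0 <= x -> flux c du 0 <= flux c du x.
Proof.
  intros hx. destruct (Req_dec x 0) as [->|h]; [lra|].
  pose proof (flux_increasing 0 x ltac:(lra) ltac:(lra)). lra.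
Qed.

End ClassicalFront.

(** * Uniqueness by comparison of two fronts *)

(** Equal to e^(c x) u2^2 (u1 / u2)', so its sign tells whether the ratio of the fronts grows. *)
Definition wronskian (c : R) (u1 du1 u2 du2 : R -> R) (x : R) : R :=
  flux c du1 x * u2 x - flux c du2 x * u1 x.

Section Uniqueness.

Variables (c : R) (u1 du1 u2 du2 : R -> R).
Hypothesis hc : 0 <= c.
Hypothesis h1 : classical_front c u1 du1.
Hypothesis h2 : classical_front c u2 du2.

Let W := wronskian c u1 du1 u2 du2.

Lemma wronskian_continuous x : continuous W x.
Proof.
  apply (continuous_minus (V := R_NormedModule)).
  - apply (continuous_mult (K := R_AbsRing)).
    + apply (flux_continuous c u1 du1 h1).
    + apply (front_continuous c u2 du2 h2).
  - apply (continuous_mult (K := R_AbsRing)).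
    + apply (flux_continuous c u2 du2 h2).
    + apply (front_continuous c u1 du1 h1).
Qed.

Lemma wronskian_derive x : x <> 0 ->
  is_derive W x (exp (c * x) * (u1 x * u2 x * (u1 x ^ 2 - u2 x ^ 2))).
Proof.
  intros hx.
  assert (a1 := front_derive c u1 du1 h1 x).
  assert (a2 := front_derive c u2 du2 h2 x).
  destruct (Rlt_dec x 0) as [hn|hn].
  - assert (b1 := flux_derive_neg c u1 du1 h1 x hn).
    assert (b2 := flux_derive_neg c u2 du2 h2 x hn).
    unfold W, wronskian. auto_derive.
    + ex_derives.
    + rewrite (is_derive_unique (fun t : R => u1 t) _ _ a1),
        (is_derive_unique (fun t : R => u2 t) _ _ a2),
        (is_derive_unique (fun t : R => flux c du1 t) _ _ b1),
        (is_derive_unique (fun t : R => flux c du2 t) _ _ b2).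
      unfold flux. ring.
  - assert (b1 := flux_derive_pos c u1 du1 h1 x ltac:(lra)).
    assert (b2 := flux_derive_pos c u2 du2 h2 x ltac:(lra)).
    unfold W, wronskian. auto_derive.
    + ex_derives.
    + rewrite (is_derive_unique (fun t : R => u1 t) _ _ a1),
        (is_derive_unique (fun t : R => u2 t) _ _ a2),
        (is_derive_unique (fun t : R => flux c du1 t) _ _ b1),
        (is_derive_unique (fun t : R => flux c du2 t) _ _ b2).
      unfold flux. ring.
Qed.

Lemma wronskian_derive_pos x : u2 x < u1 x ->
  0 < exp (c * x) * (u1 x * u2 x * (u1 x ^ 2 - u2 x ^ 2)).
Proof.
  intros h. pose proof (exp_pos (c * x)).
  pose proof (front_bounds c u1 du1 h1 x).
  pose proof (front_bounds c u2 du2 h2 x).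
  apply Rmult_lt_0_compat; [lra|]. apply Rmult_lt_0_compat; nra.
Qed.

Lemma wronskian_increasing a b : a < b ->
  (forall x, a < x < b -> u2 x < u1 x) -> W a < W b.
Proof.
  set (dW := fun x => exp (c * x) * (u1 x * u2 x * (u1 x ^ 2 - u2 x ^ 2))).
  assert (H : forall a b, a < b -> (b <= 0 \/ 0 <= a) ->
    (forall x, a < x < b -> u2 x < u1 x) -> W a < W b).
  { clear a b. intros a b hab hs hlt.
    apply (increasing_of_derive W dW); auto.
    - intros x hx. apply wronskian_derive. lra.
    - apply wronskian_continuous.
    - intros x hx. apply wronskian_derive_pos, hlt, hx. }
  intros hab hlt.
  destruct (Rle_dec b 0); [apply H; auto; lra|].
  destruct (Rle_dec 0 a); [apply H; auto; lra|].
  apply Rlt_trans with (W 0); apply H; try lra; intros; apply hlt; lra.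
Qed.

Lemma ratio_derive x :
  is_derive (fun t => u1 t / u2 t) x (exp (- c * x) * W x / u2 x ^ 2).
Proof.
  assert (a1 := front_derive c u1 du1 h1 x).
  assert (a2 := front_derive c u2 du2 h2 x).
  pose proof (front_bounds c u2 du2 h2 x).
  auto_derive.
  - ex_derives. lra.
  - rewrite (is_derive_unique (fun t : R => u1 t) _ _ a1),
        (is_derive_unique (fun t : R => u2 t) _ _ a2).
    unfold W, wronskian.
    rewrite (du_flux c du1 x), (du_flux c du2 x). field. lra.
Qed.

Lemma ratio_gt_1 x : u2 x < u1 x <-> 1 < u1 x / u2 x.
Proof.
  pose proof (front_bounds c u2 du2 h2 x).
  split; intros h.
  - apply Rlt_div_r; lra.
  - apply Rlt_div_r in h; lra.
Qed.

Lemma difference_continuous x : continuous (fun t => u1 t - u2 t) x.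
Proof.
  apply (continuous_minus (V := R_NormedModule)).
  - apply (front_continuous c u1 du1 h1).
  - apply (front_continuous c u2 du2 h2).
Qed.

Lemma ratio_continuous x : continuous (fun t => u1 t / u2 t) x.
Proof. exact (continuous_of_is_derive _ _ _ (ratio_derive x)). Qed.

(** As long as u2 < u1 the Wronskian increases, hence stays nonnegative, hence u1 / u2 does not
    decrease: it cannot come down to 1 at a first crossing z. *)
Lemma ordered_right x0 : u2 x0 < u1 x0 -> 0 <= W x0 ->
  forall x, x0 <= x -> u2 x < u1 x.
Proof.
  intros h0 hW x hx. apply Rnot_le_lt. intros hn.
  destruct (Req_dec x x0) as [->|hne]; [lra|].
  destruct (first_nonpositive (fun t => u1 t - u2 t) x0 x)
    as [z [hz1 [hz2 hz3]]]; try lra.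
  { apply difference_continuous. }
  assert (hr : u1 x0 / u2 x0 <= u1 z / u2 z).
  { apply (nondecreasing_of_derive (fun t => u1 t / u2 t)
      (fun x => exp (- c * x) * W x / u2 x ^ 2)).
    - lra.
    - intros; apply ratio_derive.
    - apply ratio_continuous.
    - intros t ht. pose proof (exp_pos (- c * t)).
      pose proof (front_bounds c u2 du2 h2 t).
      assert (W x0 < W t).
      { apply wronskian_increasing; [lra|]. intros y hy.
        specialize (hz3 y ltac:(lra)). lra. }
      apply Rdiv_le_0_compat; nra. }
  apply ratio_gt_1 in h0.
  assert (u2 z < u1 z) by (apply ratio_gt_1; lra). lra.
Qed.

(** Mirror image: going left, the Wronskian stays nonpositive and the ratio u1 / u2 does not
    fall. *)
Lemma ordered_left x0 : u2 x0 < u1 x0 -> W x0 <= 0 ->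
  forall x, x <= x0 -> u2 x < u1 x.
Proof.
  intros h0 hW x hx. apply Rnot_le_lt. intros hn.
  destruct (Req_dec x x0) as [->|hne]; [lra|].
  destruct (last_nonpositive (fun t => u1 t - u2 t) x x0)
    as [z [hz1 [hz2 hz3]]]; try lra.
  { apply difference_continuous. }
  assert (hr : u1 x0 / u2 x0 <= u1 z / u2 z).
  { apply (nonincreasing_of_derive (fun t => u1 t / u2 t)
      (fun x => exp (- c * x) * W x / u2 x ^ 2)).
    - lra.
    - intros; apply ratio_derive.
    - apply ratio_continuous.
    - intros t ht. pose proof (exp_pos (- c * t)).
      pose proof (front_bounds c u2 du2 h2 t).
      assert (W t < W x0).
      { apply wronskian_increasing; [lra|]. intros y hy.
        specialize (hz3 y ltac:(lra)). lra. }
      assert (0 <= exp (- c * t) * - W t / u2 t ^ 2).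
      { apply Rdiv_le_0_compat; nra. }
      unfold Rdiv in *. nra. }
  apply ratio_gt_1 in h0.
  assert (u2 z < u1 z) by (apply ratio_gt_1; lra). lra.
Qed.

(** The sign of W at a point with u1 > u2 selects the direction in which the order persists up to
    infinity; moving that way, W goes away from 0, against its limit 0. *)
Lemma classical_front_le x : u1 x <= u2 x.
Proof.
  apply Rnot_lt_le. intros h0.
  destruct (Rle_dec 0 (W x)) as [hW|hW].
  - assert (hord := ordered_right x h0 hW).
    (* [W x] may be 0; one unit further the Wronskian is strictly positive. *)
    set (e := W (x + 1)).
    assert (he : 0 < e).
    { unfold e. apply Rle_lt_trans with (W x); [exact hW|].
      apply wronskian_increasing; [lra|]. intros; apply hord; lra. }
    pose proof (flux_neg c u2 du2 hc h2 0) as hf.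
    (* On the right W <= - flux2 u1 <= - flux2(0) u1, which drops below e once u1 is this small. *)
    destruct (is_lim_p_infty_below u1 0 (e / - flux c du2 0)) as [X hX].
    { apply h1. }
    { apply Rdiv_lt_0_compat; lra. }
    set (y := Rmax (Rmax X (x + 1)) 0 + 1).
    assert (hy : X < y /\ x + 1 < y /\ 0 < y).
    { unfold y. pose proof (Rmax_l (Rmax X (x + 1)) 0).
      pose proof (Rmax_r (Rmax X (x + 1)) 0).
      pose proof (Rmax_l X (x + 1)). pose proof (Rmax_r X (x + 1)). lra. }
    specialize (hX y ltac:(lra)). apply Rlt_div_r in hX; [|lra].
    assert (hWy : e < W y).
    { apply wronskian_increasing; [lra|]. intros; apply hord; lra. }
    unfold W, wronskian in hWy.
    pose proof (flux_neg c u1 du1 hc h1 y).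
    pose proof (front_bounds c u2 du2 h2 y).
    pose proof (front_bounds c u1 du1 h1 y).
    pose proof (flux_lower_right c u2 du2 h2 y ltac:(lra)). nra.
  - apply Rnot_le_lt in hW.
    assert (hord := ordered_left x h0 (Rlt_le _ _ hW)).
    assert (hWi : / W x < 0) by (apply Rinv_lt_0_compat; exact hW).
    (* Chosen so that 1 / y >= W x, while [flux_lower_left] gives W y > flux1 y > 1 / y. *)
    set (y := Rmin (x - 1) (/ W x)).
    assert (hy1 : y <= x - 1) by apply Rmin_l.
    assert (hy2 : y <= / W x) by apply Rmin_r.
    assert (hWy : W y < W x).
    { apply wronskian_increasing; [lra|]. intros; apply hord; lra. }
    assert (hiy : W x <= / y).
    { rewrite <- (Rinv_inv (W x)).
      apply Ropp_le_cancel. rewrite <- (Rinv_opp y), <- (Rinv_opp (/ W x)).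
      apply Rinv_le_contravar; lra. }
    pose proof (flux_lower_left c u1 du1 hc h1 y ltac:(lra)).
    unfold W at 1, wronskian in hWy.
    pose proof (flux_neg c u1 du1 hc h1 y).
    pose proof (flux_neg c u2 du2 hc h2 y).
    pose proof (front_bounds c u2 du2 h2 y).
    pose proof (front_bounds c u1 du1 h1 y).
    assert (flux c du1 y * (1 - u2 y) < 0) by nra.
    assert (flux c du2 y * u1 y < 0) by nra. lra.
Qed.

End Uniqueness.

Lemma classical_front_unique (c : R) (u1 du1 u2 du2 : R -> R) :
  0 <= c -> classical_front c u1 du1 -> classical_front c u2 du2 -> u1 = u2.
Proof.
  intros hc h1 h2. apply functional_extensionality. intros x.
  apply Rle_antisym.
  - exact (classical_front_le c u1 du1 u2 du2 hc h1 h2 x).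
  - exact (classical_front_le c u2 du2 u1 du1 hc h2 h1 x).
Qed.

(** * Exponential rates and the speed bound *)

Lemma exp_nondecreasing (x y : R) : x <= y -> exp x <= exp y.
Proof.
  intros [h| ->]; [left; apply exp_increasing, h|right; reflexivity].
Qed.

Lemma exp_small_at_m_infty (k eta X : R) : 0 < k -> 0 < eta ->
  exists y, y < X /\ exp (k * y) < eta.
Proof.
  intros hk he. exists (Rmin (X - 1) (ln eta / k - 1)).
  set (y := Rmin _ _).
  assert (h1 : y <= X - 1) by apply Rmin_l.
  assert (h2 : y <= ln eta / k - 1) by apply Rmin_r.
  split; [lra|]. rewrite <- (exp_ln eta) by exact he.
  apply exp_increasing.
  apply Rlt_le_trans with (k * (ln eta / k)).
  - apply Rmult_lt_compat_l; lra.
  - right. field. lra.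
Qed.

Section Decay.

Variables (c : R) (u du : R -> R).
Hypothesis hc : 0 <= c.
Hypothesis hu : classical_front c u du.

(* [k] is the decay rate of the linearisation [u'' + c u' - u = 0] at 0; the
   combination [u' + k u] would grow exponentially as soon as it is positive. *)
Lemma slope_right k : 0 < k -> k * k = c * k + 1 ->
  forall x, 0 <= x -> du x + k * u x <= 0.
Proof.
  intros hk ek x0 hx0. apply Rnot_lt_le. intros hz.
  (* Since c = k - 1 / k, the operator D^2 + c D - 1 factors as (D - 1 / k) (D + k), so that Z' =
     e^(- x / k) u^3 >= 0. *)
  set (Z := fun x => exp (- / k * x) * (du x + k * u x)).
  assert (hmono : forall x, x0 < x -> Z x0 <= Z x).
  { intros x hx.
    apply (nondecreasing_of_derive Z (fun t => exp (- / k * t) * u t ^ 3)).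
    - lra.
    - intros t ht.
      assert (a1 := front_derive c u du hu t).
      assert (a2 := proj2 (proj2 (proj2 (proj1 hu))) t ltac:(lra)).
      unfold Z. auto_derive.
      + ex_derives.
      + rewrite (is_derive_unique (fun t : R => u t) _ _ a1),
          (is_derive_unique (fun t : R => du t) _ _ a2).
        replace (c) with (k - / k); [field; lra|].
        apply Rmult_eq_reg_r with k; [|lra]. field_simplify; lra.
    - intros t. apply (continuous_mult (K := R_AbsRing)).
      + apply continuous_exp_lin.
      + apply (continuous_plus (V := R_NormedModule)).
        * apply (front_derive_continuous c u du hu).
        * apply (continuous_scal_r (V := R_NormedModule)).
          apply (front_continuous c u du hu).
    - intros t ht. pose proof (exp_pos (- / k * t)).
      pose proof (front_bounds c u du hu t).
      apply Rmult_le_pos; [lra|]. apply pow_le; lra. }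
  assert (hZ0 : 0 < Z x0).
  { unfold Z. apply Rmult_lt_0_compat; [apply exp_pos|exact hz]. }
  assert (hik : 0 < / k) by (apply Rinv_0_lt_compat, hk).
  (* As u' < 0 and u < 1, Z <= k e^(- x / k), which falls below [Z x0] at the far right point -
     y. *)
  destruct (exp_small_at_m_infty (/ k) (Z x0 / k) (- x0 - 1)) as [y [hy1 hy2]].
  { exact hik. }
  { apply Rdiv_lt_0_compat; lra. }
  pose proof (hmono (- y) ltac:(lra)) as h. unfold Z at 2 in h.
  replace (- / k * - y) with (/ k * y) in h by ring.
  apply Rlt_div_r in hy2; [|lra].
  pose proof (front_bounds c u du hu (- y)).
  pose proof (du_neg c u du hc hu (- y)).
  pose proof (exp_pos (/ k * y)).
  assert (exp (/ k * y) * (du (- y) + k * u (- y)) <= exp (/ k * y) * k).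
  { apply Rmult_le_compat_l; [lra|]. nra. }
  lra.
Qed.

(** The positive root of k^2 - c k - 1. The inequality c / 2 < k is what contradicts the slope bound
    from the left in [classical_front_speed]. *)
Lemma linear_rate_exists :
  exists k, 0 < k /\ c / 2 < k /\ k * k = c * k + 1.
Proof.
  set (s := sqrt (c * c + 4)).
  assert (hs : s * s = c * c + 4) by (apply sqrt_sqrt; nra).
  assert (hs0 : 0 < s) by (apply sqrt_lt_R0; nra).
  exists ((c + s) / 2). repeat split; nra.
Qed.

Lemma classical_front_rate_p_infty : exp_rate_p_infty u 0.
Proof.
  destruct linear_rate_exists as [k [hk [_ ek]]].
  exists (u 0), k, 0. split; [exact hk|]. intros x hx.
  assert (h : exp (k * x) * u x <= exp (k * 0) * u 0).
  { apply (nonincreasing_of_derive (fun t => exp (k * t) * u t)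
      (fun t => exp (k * t) * (du t + k * u t))).
    - exact hx.
    - intros t ht. assert (a1 := front_derive c u du hu t).
      auto_derive; [ex_derives|].
      rewrite (is_derive_unique (fun t : R => u t) _ _ a1). ring.
    - intros t. apply (continuous_mult (K := R_AbsRing)).
      + apply continuous_exp_lin.
      + apply (front_continuous c u du hu).
    - intros t ht. pose proof (slope_right k hk ek t ltac:(lra)).
      pose proof (exp_pos (k * t)). nra. }
  rewrite Rmult_0_r, exp_0, Rmult_1_l in h.
  pose proof (front_bounds c u du hu x).
  rewrite Rminus_0_r, Rabs_right by lra.
  replace (u x) with ((exp (k * x) * u x) * exp (- k * x)).
  - apply Rmult_le_compat_r; [left; apply exp_pos|exact h].
  - replace (- k * x) with (- (k * x)) by ring. rewrite exp_Ropp. field.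
    apply Rgt_not_eq, exp_pos.
Qed.

(** The weighted difference Z has derivative e^((c + k) t) (1 - u) (u (1 + u) - k (c + k)), and u >=
    1 / 2 gives u (1 + u) >= 3 / 4. So Z is nondecreasing; a negative value would persist towards
    -oo, where Z >= - k e^(k y). *)
Lemma slope_left k x0 : 0 < k -> k * (c + k) <= 3 / 4 -> x0 <= 0 ->
  (forall x, x < x0 -> / 2 <= u x) ->
  forall x, x <= x0 -> 0 <= - du x - k * (1 - u x).
Proof.
  intros hk hk2 hx0 hhalf x hx. apply Rnot_lt_le. intros hz.
  set (Z := fun x => exp ((c + k) * x) * (- du x - k * (1 - u x))).
  assert (hmono : forall y, y < x -> Z y <= Z x).
  { intros y hy.
    apply (nondecreasing_of_derive Z (fun t => exp ((c + k) * t) *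
      ((1 - u t) * (u t * (1 + u t) - k * (c + k))))).
    - lra.
    - intros t ht.
      assert (a1 := front_derive c u du hu t).
      assert (a2 := proj1 (proj2 (proj2 (proj1 hu))) t ltac:(lra)).
      unfold Z. auto_derive.
      + ex_derives.
      + rewrite (is_derive_unique (fun t : R => u t) _ _ a1),
          (is_derive_unique (fun t : R => du t) _ _ a2). ring.
    - intros t. apply (continuous_mult (K := R_AbsRing)).
      + apply continuous_exp_lin.
      + apply (continuous_minus (V := R_NormedModule)).
        * apply (continuous_opp (V := R_NormedModule)).
          apply (front_derive_continuous c u du hu).
        * apply (continuous_scal_r (V := R_NormedModule)).
          apply (continuous_minus (V := R_NormedModule)).
          -- apply continuous_const.
          -- apply (front_continuous c u du hu).
    - intros t ht. pose proof (exp_pos ((c + k) * t)).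
      pose proof (front_bounds c u du hu t).
      pose proof (hhalf t ltac:(lra)).
      apply Rmult_le_pos; [lra|]. apply Rmult_le_pos; nra. }
  assert (hZ0 : Z x < 0).
  { unfold Z. pose proof (exp_pos ((c + k) * x)). nra. }
  destruct (exp_small_at_m_infty k (- Z x / k) x hk) as [y [hy1 hy2]].
  { apply Rdiv_lt_0_compat; lra. }
  pose proof (hmono y hy1) as h. unfold Z at 1 in h.
  apply Rlt_div_r in hy2; [|lra].
  rewrite Rmult_plus_distr_r, exp_plus in h.
  pose proof (front_bounds c u du hu y).
  pose proof (du_neg c u du hc hu y).
  pose proof (exp_pos (k * y)). pose proof (exp_pos (c * y)).
  assert (exp (c * y) <= 1).
  { rewrite <- exp_0. apply exp_nondecreasing. nra. }
  set (a := exp (c * y)) in *. set (b := exp (k * y)) in *.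
  assert (a * (1 - u y) <= 1) by nra.
  assert (0 < a * b) by nra. assert (a * b * (- du y) >= 0) by nra.
  assert (a * (1 - u y) * (b * k) <= 1 * (b * k)).
  { apply Rmult_le_compat_r; nra. }
  nra.
Qed.

Lemma classical_front_rate_m_infty : exp_rate_m_infty u 1.
Proof.
  (* Here k <= 1, so k (c + k) <= k (c + 1) = 3 / 4 as [slope_left] requires. *)
  set (k := 3 / (4 * (c + 1))).
  assert (hk : 0 < k) by (apply Rdiv_lt_0_compat; lra).
  assert (ek : k * (c + 1) = 3 / 4) by (unfold k; field; lra).
  destruct (is_lim_m_infty_above u 1 (/ 2)) as [X hX]; [apply hu|lra|].
  set (x0 := Rmin X 0).
  assert (h1 : x0 <= X) by apply Rmin_l.
  assert (h2 : x0 <= 0) by apply Rmin_r.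
  exists (exp (- k * x0) * (1 - u x0)), k, x0. split; [exact hk|].
  intros x hx.
  assert (h : exp (- k * x) * (1 - u x) <= exp (- k * x0) * (1 - u x0)).
  { apply (nondecreasing_of_derive (fun t => exp (- k * t) * (1 - u t))
      (fun t => exp (- k * t) * (- du t - k * (1 - u t)))).
    - exact hx.
    - intros t ht. assert (a1 := front_derive c u du hu t).
      auto_derive; [ex_derives|].
      rewrite (is_derive_unique (fun t : R => u t) _ _ a1). ring.
    - intros t. apply (continuous_mult (K := R_AbsRing)).
      + apply continuous_exp_lin.
      + apply (continuous_minus (V := R_NormedModule)).
        * apply continuous_const.
        * apply (front_continuous c u du hu).
    - intros t ht. apply Rmult_le_pos; [left; apply exp_pos|].
      apply (slope_left k x0); try lra; try nra.
      intros y hy. left. apply hX. lra. }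
  pose proof (front_bounds c u du hu x).
  rewrite Rabs_left by lra.
  replace (- (u x - 1)) with ((exp (- k * x) * (1 - u x)) * exp (k * x)).
  - apply Rmult_le_compat_r; [left; apply exp_pos|exact h].
  - replace (- k * x) with (- (k * x)) by ring. rewrite exp_Ropp. field.
    apply Rgt_not_eq, exp_pos.
Qed.

(* On the left the logarithmic slope stays above [- c / 2], while [slope_right]
   forces it below at the origin. *)
Lemma classical_front_speed (M : R) : (forall x, - M <= du x) -> c <= 2.
Proof.
  intros hM. apply Rnot_lt_le. intros hc2.
  (* Z is the derivative of e^(c x / 2) u, which is convex on the left when c > 2. Since u' >= - M,
     Z >= - M e^(c y / 2) near -oo, so a negative value of Z at 0 is impossible. *)
  set (Z := fun x => exp (c / 2 * x) * (du x + c / 2 * u x)).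
  assert (hmono : forall y, y < 0 -> Z y <= Z 0).
  { intros y hy.
    apply (nondecreasing_of_derive Z (fun t => exp (c / 2 * t) *
      ((c * c / 4 - 1) * u t + u t ^ 3))).
    - lra.
    - intros t ht.
      assert (a1 := front_derive c u du hu t).
      assert (a2 := proj1 (proj2 (proj2 (proj1 hu))) t ltac:(lra)).
      unfold Z. auto_derive.
      + ex_derives.
      + rewrite (is_derive_unique (fun t : R => u t) _ _ a1),
          (is_derive_unique (fun t : R => du t) _ _ a2).
        unfold Rdiv. set (e := exp _). field.
    - intros t. apply (continuous_mult (K := R_AbsRing)).
      + apply continuous_exp_lin.
      + apply (continuous_plus (V := R_NormedModule)).
        * apply (front_derive_continuous c u du hu).
        * apply (continuous_scal_r (V := R_NormedModule)).
          apply (front_continuous c u du hu).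
    - intros t ht. pose proof (exp_pos (c / 2 * t)).
      pose proof (front_bounds c u du hu t).
      apply Rmult_le_pos; [lra|]. apply Rplus_le_le_0_compat.
      + apply Rmult_le_pos; nra.
      + apply pow_le; lra. }
  destruct linear_rate_exists as [k [hk [hk2 ek]]].
  pose proof (slope_right k hk ek 0 (Rle_refl 0)).
  pose proof (front_bounds c u du hu 0).
  assert (hZ0 : Z 0 < 0).
  { unfold Z. rewrite Rmult_0_r, exp_0. nra. }
  assert (hM1 : 0 < M).
  { pose proof (du_neg c u du hc hu 0). specialize (hM 0). lra. }
  destruct (exp_small_at_m_infty (c / 2) (- Z 0 / M) 0) as [y [hy1 hy2]].
  { lra. }
  { apply Rdiv_lt_0_compat; lra. }
  pose proof (hmono y hy1) as h. unfold Z at 1 in h.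
  apply Rlt_div_r in hy2; [|lra].
  pose proof (exp_pos (c / 2 * y)). specialize (hM y).
  pose proof (front_bounds c u du hu y).
  assert (exp (c / 2 * y) * - M <= exp (c / 2 * y) * (du y + c / 2 * u y)).
  { apply Rmult_le_compat_l; nra. }
  lra.
Qed.

End Decay.

(** * Integration across the jump at 0 *)

Lemma constant_of_derive_off_0 (f : R -> R) :
  (forall x, continuous f x) -> (forall x, x <> 0 -> is_derive f x 0) ->
  forall x y, f x = f y.
Proof.
  intros hc hd.
  assert (H : forall a b, a <= b -> (b <= 0 \/ 0 <= a) -> f a = f b).
  { intros a b hab hs. apply Rle_antisym.
    - apply (nondecreasing_of_derive f (fun _ => 0)); auto;
        intros; try apply hd; lra.
    - apply (nonincreasing_of_derive f (fun _ => 0)); auto;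
        intros; try apply hd; lra. }
  assert (H0 : forall x, f x = f 0).
  { intros x. destruct (Rle_dec x 0); [|symmetry]; apply H; lra. }
  intros x y. rewrite (H0 x), (H0 y). reflexivity.
Qed.

(** Both pieces are continuous on all of R, which encodes finite one-sided limits at 0 and makes
    integrability up to 0 immediate. The value at 0 is left free, as in [is_step]. *)
Definition piecewise_continuous (f : R -> R) : Prop :=
  exists f1 f2 : R -> R,
    (forall x, continuous f1 x) /\ (forall x, continuous f2 x) /\
    (forall x, x < 0 -> f x = f1 x) /\ (forall x, 0 < x -> f x = f2 x).

Lemma piecewise_continuous_of_continuous (f : R -> R) :
  (forall x, continuous f x) -> piecewise_continuous f.
Proof. intros h. exists f, f. auto. Qed.

Lemma piecewise_continuous_mult (f g : R -> R) :
  piecewise_continuous f -> piecewise_continuous g ->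
  piecewise_continuous (fun x => f x * g x).
Proof.
  intros [f1 [f2 [hf1 [hf2 [ef1 ef2]]]]] [g1 [g2 [hg1 [hg2 [eg1 eg2]]]]].
  exists (fun x => f1 x * g1 x), (fun x => f2 x * g2 x).
  repeat split; intros x.
  - apply (continuous_mult (K := R_AbsRing)); auto.
  - apply (continuous_mult (K := R_AbsRing)); auto.
  - intros hx. rewrite ef1, eg1; auto.
  - intros hx. rewrite ef2, eg2; auto.
Qed.

Lemma piecewise_continuous_plus (f g : R -> R) :
  piecewise_continuous f -> piecewise_continuous g ->
  piecewise_continuous (fun x => f x + g x).
Proof.
  intros [f1 [f2 [hf1 [hf2 [ef1 ef2]]]]] [g1 [g2 [hg1 [hg2 [eg1 eg2]]]]].
  exists (fun x => f1 x + g1 x), (fun x => f2 x + g2 x).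
  repeat split; intros x.
  - apply (continuous_plus (V := R_NormedModule)); auto.
  - apply (continuous_plus (V := R_NormedModule)); auto.
  - intros hx. rewrite ef1, eg1; auto.
  - intros hx. rewrite ef2, eg2; auto.
Qed.

Lemma ex_RInt_of_continuous (f : R -> R) (a b : R) :
  (forall x, continuous f x) -> ex_RInt f a b.
Proof.
  intros h. apply (ex_RInt_continuous (V := R_CompleteNormedModule)); auto.
Qed.

Lemma piecewise_continuous_ex_RInt (f : R -> R) (a b : R) :
  piecewise_continuous f -> ex_RInt f a b.
Proof.
  intros [f1 [f2 [hf1 [hf2 [ef1 ef2]]]]].
  assert (H : forall x, ex_RInt f x 0).
  { intros x. destruct (Rle_dec x 0).
    - apply ex_RInt_ext with f1; [|apply ex_RInt_of_continuous, hf1].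
      rewrite Rmin_left, Rmax_right by lra.
      intros t ht. symmetry. apply ef1. lra.
    - apply ex_RInt_ext with f2; [|apply ex_RInt_of_continuous, hf2].
      rewrite Rmin_right, Rmax_left by lra.
      intros t ht. symmetry. apply ef2. lra. }
  apply ex_RInt_Chasles with 0; [apply H|apply ex_RInt_swap, H].
Qed.

Lemma piecewise_continuous_off_0 (f : R -> R) (x : R) :
  piecewise_continuous f -> x <> 0 -> continuous f x.
Proof.
  intros [f1 [f2 [hf1 [hf2 [ef1 ef2]]]]] hx.
  destruct (Rlt_dec x 0).
  - apply (continuous_ext_loc _ f1); [|apply hf1].
    apply (filter_imp (fun y => y < 0)); [|apply open_lt; lra].
    intros y hy. symmetry. apply ef1, hy.
  - apply (continuous_ext_loc _ f2); [|apply hf2].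
    apply (filter_imp (fun y => 0 < y)); [|apply open_gt; lra].
    intros y hy. symmetry. apply ef2, hy.
Qed.

Lemma continuous_RInt_upper (f : R -> R) (a x : R) :
  (forall a b, ex_RInt f a b) -> continuous (fun y => RInt f a y) x.
Proof.
  intros h. apply (continuous_RInt_1 (V := R_CompleteNormedModule) f a x).
  apply filter_forall. intros z.
  apply (RInt_correct (V := R_CompleteNormedModule)), h.
Qed.

Lemma is_derive_RInt_upper (f : R -> R) (a x : R) :
  (forall a b, ex_RInt f a b) -> continuous f x ->
  is_derive (fun y => RInt f a y) x (f x).
Proof.
  intros h hc. apply (is_derive_RInt (V := R_NormedModule) f _ a x); auto.
  apply filter_forall. intros z.
  apply (RInt_correct (V := R_CompleteNormedModule)), h.
Qed.

(** The fundamental theorem with an exceptional point: F minus the primitive of f is continuous with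
    derivative 0 off 0, hence constant. *)
Lemma is_RInt_derive_piecewise (F f : R -> R) (a b : R) :
  (forall x, continuous F x) -> piecewise_continuous f ->
  (forall x, x <> 0 -> is_derive F x (f x)) ->
  is_RInt f a b (F b - F a).
Proof.
  intros hF hf hd.
  assert (hex : forall a b, ex_RInt f a b)
    by (intros; apply piecewise_continuous_ex_RInt, hf).
  assert (e : F b - RInt f a b = F a - RInt f a a).
  { apply (constant_of_derive_off_0 (fun x => F x - RInt f a x)).
    - intros x. apply (continuous_minus (V := R_NormedModule)); [apply hF|].
      apply continuous_RInt_upper, hex.
    - intros x hx. replace 0 with (f x - f x) by ring.
      apply (is_derive_minus (V := R_NormedModule)); [apply hd, hx|].
      apply is_derive_RInt_upper; [apply hex|].
      apply piecewise_continuous_off_0; auto. }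
  rewrite RInt_point in e. change (@zero R_CompleteNormedModule) with 0 in e.
  replace (F b - F a) with (RInt f a b) by lra.
  apply (RInt_correct (V := R_CompleteNormedModule)), hex.
Qed.

(** * Smooth bump functions *)

(** Quantifying over the successive derivatives turns closure under sums and products into a short
    induction, with no formula for [Derive_n]. *)
Fixpoint smooth_upto (n : nat) (f : R -> R) : Prop :=
  match n with
  | O => True
  | S n => exists df, (forall x, is_derive f x (df x)) /\ smooth_upto n df
  end.

Lemma smooth_upto_ex_derive_n (n : nat) (f : R -> R) :
  smooth_upto n f -> forall x, ex_derive_n f n x.
Proof.
  revert f. induction n as [|n IH]; [intros; exact I|].
  intros f [df [hd hs]] x.
  destruct n as [|n]; [exists (df x); apply hd|].
  specialize (IH df hs x).
  apply (ex_derive_ext (Derive_n df n)); [|exact IH].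
  intros t.
  replace df with (Derive_n f 1).
  - rewrite (Derive_n_comp f n 1). f_equal. lia.
  - apply functional_extensionality. intros y. apply is_derive_unique, hd.
Qed.

Lemma smooth_upto_pred (n : nat) (f : R -> R) :
  smooth_upto (S n) f -> smooth_upto n f.
Proof.
  revert f. induction n as [|n IH]; [intros; exact I|].
  intros f [df [hd hs]]. exists df. split; auto.
Qed.

Lemma smooth_upto_const (n : nat) (k : R) : smooth_upto n (fun _ => k).
Proof.
  revert k. induction n as [|n IH]; [intros; exact I|].
  intros k. exists (fun _ => 0). split; [|apply IH].
  intros x. apply (is_derive_const (V := R_NormedModule)).
Qed.

Lemma smooth_upto_plus (n : nat) (f g : R -> R) :
  smooth_upto n f -> smooth_upto n g -> smooth_upto n (fun x => f x + g x).
Proof.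
  revert f g. induction n as [|n IH]; [intros; exact I|].
  intros f g [df [hf sf]] [dg [hg sg]]. exists (fun x => df x + dg x).
  split; [|apply IH; auto].
  intros x. apply (is_derive_plus (V := R_NormedModule)); auto.
Qed.

Lemma smooth_upto_mult (n : nat) (f g : R -> R) :
  smooth_upto n f -> smooth_upto n g -> smooth_upto n (fun x => f x * g x).
Proof.
  revert f g. induction n as [|n IH]; [intros; exact I|].
  intros f g hsf hsg.
  assert (sf' := smooth_upto_pred _ _ hsf).
  assert (sg' := smooth_upto_pred _ _ hsg).
  destruct hsf as [df [hf sf]]. destruct hsg as [dg [hg sg]].
  exists (fun x => df x * g x + f x * dg x). split.
  - intros x. apply (is_derive_mult (K := R_AbsRing) f g); auto.
    intros; apply Rmult_comm.
  - apply smooth_upto_plus; apply IH; auto.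
Qed.

Lemma smooth_upto_comp_lin (n : nat) (f : R -> R) (a b : R) :
  smooth_upto n f -> smooth_upto n (fun x => f (a * x + b)).
Proof.
  revert f. induction n as [|n IH]; [intros; exact I|].
  intros f [df [hf sf]]. exists (fun x => a * df (a * x + b)). split.
  - intros x.
    apply (is_derive_comp (V := R_NormedModule) f (fun x => a * x + b)); auto.
    auto_derive; auto; ring.
  - apply (smooth_upto_mult n (fun _ => a)); [apply smooth_upto_const|auto].
Qed.

(** Split e^t into two factors e^(t / 2): one dominates t / 2, the other (t / 2)^n by induction. *)
Lemma pow_le_exp (n : nat) :
  exists C, 0 <= C /\ forall t, 0 <= t -> t ^ n <= C * exp t.
Proof.
  induction n as [|n [C [hC IH]]].
  - exists 1. split; [lra|]. intros t ht. simpl.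
    pose proof (exp_ineq1_le t). lra.
  - exists (2 ^ S n * C).
    assert (h2 : 0 < 2 ^ S n) by (apply pow_lt; lra).
    split; [nra|]. intros t ht.
    replace (t ^ S n) with (2 ^ S n * (t / 2) ^ S n)
      by (rewrite <- Rpow_mult_distr; f_equal; field).
    rewrite Rmult_assoc. apply Rmult_le_compat_l; [lra|].
    replace (exp t) with (exp (t / 2) * exp (t / 2))
      by (rewrite <- exp_plus; f_equal; field).
    specialize (IH (t / 2) ltac:(lra)).
    pose proof (exp_ineq1_le (t / 2)).
    assert (0 <= (t / 2) ^ n) by (apply pow_le; lra).
    simpl. set (e := exp (t / 2)) in *. set (p := (t / 2) ^ n) in *.
    apply Rle_trans with (e * p); [nra|].
    replace (C * (e * e)) with (e * (C * e)) by ring.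
    apply Rmult_le_compat_l; lra.
Qed.

(* The family is closed under derivation, see [is_derive_flat]. *)
Definition flat (k : nat) (x : R) : R :=
  if Rle_dec x 0 then 0 else (/ x) ^ k * exp (- / x).

Lemma flat_nonpos k x : x <= 0 -> flat k x = 0.
Proof. intros h. unfold flat. destruct (Rle_dec x 0); lra. Qed.

Lemma flat_pos k x : 0 < x -> flat k x = (/ x) ^ k * exp (- / x).
Proof. intros h. unfold flat. destruct (Rle_dec x 0); lra. Qed.

(** Put s = 1 / x in s^(k + 2) <= C e^s. A bound of order x^2 is what gives [flat] derivative 0 at
    the origin. *)
Lemma flat_quadratic k :
  exists C, 0 <= C /\ forall x, Rabs (flat k x) <= C * x ^ 2.
Proof.
  destruct (pow_le_exp (S (S k))) as [C [hC h]].
  exists C. split; [exact hC|]. intros x.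
  destruct (Rle_dec x 0).
  - rewrite flat_nonpos, Rabs_R0 by lra. apply Rmult_le_pos; nra.
  - rewrite flat_pos by lra.
    assert (hi : 0 < / x) by (apply Rinv_0_lt_compat; lra).
    specialize (h (/ x) (Rlt_le _ _ hi)).
    assert (he : 0 < exp (- / x)) by apply exp_pos.
    rewrite Rabs_right.
    2:{ apply Rle_ge, Rmult_le_pos; [apply pow_le|]; lra. }
    replace ((/ x) ^ k * exp (- / x))
      with ((/ x) ^ S (S k) * exp (- / x) * x ^ 2).
    + apply Rmult_le_compat_r; [nra|].
      replace C with (C * exp (/ x) * exp (- / x)).
      * apply Rmult_le_compat_r; lra.
      * rewrite Rmult_assoc, <- exp_plus, Rplus_opp_r, exp_0. ring.
    + simpl. field. lra.
Qed.

Lemma is_derive_0_of_quadratic (f : R -> R) (C : R) :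
  0 <= C -> (forall x, Rabs (f x) <= C * x ^ 2) -> is_derive f 0 0.
Proof.
  intros hC h. apply is_derive_Reals. intros eps heps.
  assert (hd : 0 < eps / (C + 1)) by (apply Rdiv_lt_0_compat; lra).
  exists (mkposreal _ hd). intros y hy1 hy2. simpl in hy2.
  assert (f0 : f 0 = 0).
  { specialize (h 0). apply Rabs_eq_0. pose proof (Rabs_pos (f 0)).
    simpl in h. lra. }
  rewrite f0, Rplus_0_l, !Rminus_0_r.
  assert (hy : 0 < Rabs y) by (apply Rabs_pos_lt, hy1).
  unfold Rdiv. rewrite Rabs_mult, Rabs_inv.
  apply Rlt_div_r in hy2; [|lra].
  apply Rle_lt_trans with (C * Rabs y); [|nra].
  apply Rmult_le_reg_r with (Rabs y); [exact hy|].
  rewrite Rmult_assoc, Rinv_l, Rmult_1_r by lra.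
  specialize (h y). rewrite <- (pow2_abs y) in h. nra.
Qed.

Lemma is_derive_flat k x :
  is_derive (flat k) x (flat (k + 2) x + - INR k * flat (k + 1) x).
Proof.
  destruct (Rtotal_order x 0) as [hx|[hx|hx]].
  - rewrite !flat_nonpos by lra.
    apply (is_derive_ext_loc (fun _ => 0)).
    + apply (filter_imp (fun y => y < 0)); [|apply open_lt; lra].
      intros y hy. rewrite flat_nonpos; lra.
    + replace (0 + - INR k * 0) with 0 by ring.
      apply (is_derive_const (V := R_NormedModule)).
  - subst x. rewrite !flat_nonpos by lra.
    replace (0 + - INR k * 0) with 0 by ring.
    destruct (flat_quadratic k) as [C [hC h]].
    exact (is_derive_0_of_quadratic _ C hC h).
  - rewrite !flat_pos by lra.
    apply (is_derive_ext_loc (fun x => (/ x) ^ k * exp (- / x))).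
    + apply (filter_imp (fun y => 0 < y)); [|apply open_gt; lra].
      intros y hy. rewrite flat_pos; lra.
    + auto_derive; [lra|].
      destruct k as [|k].
      * simpl. field. lra.
      * rewrite !pow_add. simpl (Nat.pred _). simpl pow. field. lra.
Qed.

Lemma smooth_upto_flat n k : smooth_upto n (flat k).
Proof.
  revert k. induction n as [|n IH]; [intros; exact I|].
  intros k. eexists. split; [apply is_derive_flat|].
  apply smooth_upto_plus; [apply IH|].
  apply (smooth_upto_mult n (fun _ => - INR k)); [apply smooth_upto_const|].
  apply IH.
Qed.

(** Positive exactly for |x| < e when e > 0. The factors 1 and -1 are written out to fit
    [smooth_upto_comp_lin]. *)
Definition bump (e x : R) : R := flat 0 (1 * x + e) * flat 0 (-1 * x + e).

Lemma flat_nonneg k x : 0 <= flat k x.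
Proof.
  destruct (Rle_dec x 0).
  - rewrite flat_nonpos; lra.
  - rewrite flat_pos by lra. apply Rmult_le_pos.
    + apply pow_le. left. apply Rinv_0_lt_compat. lra.
    + left. apply exp_pos.
Qed.

Lemma bump_nonneg e x : 0 <= bump e x.
Proof. apply Rmult_le_pos; apply flat_nonneg. Qed.

Lemma bump_0_pos e : 0 < e -> 0 < bump e 0.
Proof.
  intros h. unfold bump. rewrite !Rmult_0_r, !Rplus_0_l.
  rewrite flat_pos by exact h. simpl. rewrite Rmult_1_l.
  apply Rmult_lt_0_compat; apply exp_pos.
Qed.

Lemma bump_outside e x : e <= Rabs x -> bump e x = 0.
Proof.
  intros h. unfold bump, Rabs in *. destruct (Rcase_abs x).
  - rewrite (flat_nonpos 0 (1 * x + e)) by lra. ring.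
  - rewrite (flat_nonpos 0 (-1 * x + e)) by lra. ring.
Qed.

Lemma smooth_upto_bump n e : smooth_upto n (bump e).
Proof.
  apply smooth_upto_mult; apply smooth_upto_comp_lin, smooth_upto_flat.
Qed.

Lemma bump_continuous e x : continuous (bump e) x.
Proof.
  destruct (smooth_upto_bump 1 e) as [d [h _]].
  exact (continuous_of_is_derive _ _ _ (h x)).
Qed.

Definition bump_primitive (e x : R) : R := RInt (bump e) (- e) x.

Lemma bump_primitive_derive e x :
  is_derive (bump_primitive e) x (bump e x).
Proof.
  apply is_derive_RInt_upper; [|apply bump_continuous].
  intros; apply ex_RInt_of_continuous, bump_continuous.
Qed.

Lemma constant_where_derive_0 (f : R -> R) (a b : R) :
  (forall x, continuous f x) -> (forall x, a < x < b -> is_derive f x 0) ->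
  a <= b -> f a = f b.
Proof.
  intros hc hd hab. apply Rle_antisym.
  - apply (nondecreasing_of_derive f (fun _ => 0)); auto;
      intros; lra.
  - apply (nonincreasing_of_derive f (fun _ => 0)); auto;
      intros; lra.
Qed.

Lemma bump_primitive_left e x : 0 < e -> x <= - e -> bump_primitive e x = 0.
Proof.
  intros he hx. transitivity (bump_primitive e (- e)).
  - apply constant_where_derive_0; [| |exact hx].
    + intros y.
      exact (continuous_of_is_derive _ _ _ (bump_primitive_derive e y)).
    + intros y hy. rewrite <- (bump_outside e y).
      * apply bump_primitive_derive.
      * rewrite Rabs_left; lra.
  - apply (RInt_point (V := R_CompleteNormedModule)).
Qed.

Lemma bump_primitive_right e x : 0 < e -> e <= x ->
  bump_primitive e x = bump_primitive e e.
Proof.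
  intros he hx. symmetry.
  apply constant_where_derive_0; [| |exact hx].
  - intros y.
      exact (continuous_of_is_derive _ _ _ (bump_primitive_derive e y)).
  - intros y hy. rewrite <- (bump_outside e y).
    + apply bump_primitive_derive.
    + rewrite Rabs_right; lra.
Qed.

(** The test function that compares the values of a function at p and q: its derivative is a bump at
    p minus a bump at q. It has compact support because both primitives reach the same constant. *)
Definition dipole (e p q x : R) : R :=
  bump_primitive e (1 * x + - p) + -1 * bump_primitive e (1 * x + - q).

Lemma is_derive_dipole e p q x :
  is_derive (dipole e p q) x (bump e (1 * x + - p) + -1 * bump e (1 * x + - q)).
Proof.
  assert (hs : forall r, is_derive (fun x => bump_primitive e (1 * x + - r)) x
    (bump e (1 * x + - r))).
  { intros r. rewrite <- (Rmult_1_l (bump e (1 * x + - r))).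
    apply (is_derive_comp (V := R_NormedModule) (bump_primitive e)
      (fun x => 1 * x + - r)).
    - apply bump_primitive_derive.
    - auto_derive; auto; ring. }
  apply (is_derive_plus (V := R_NormedModule)); [apply hs|].
  apply (is_derive_scal (fun x => bump_primitive e (1 * x + - q)) x (-1)).
  apply hs.
Qed.

Lemma dipole_outside e p q x : 0 < e ->
  x <= Rmin p q - e \/ Rmax p q + e <= x -> dipole e p q x = 0.
Proof.
  intros he h. unfold dipole.
  pose proof (Rmin_l p q). pose proof (Rmin_r p q).
  pose proof (Rmax_l p q). pose proof (Rmax_r p q).
  destruct h as [h|h].
  - rewrite !bump_primitive_left by lra. ring.
  - rewrite !(bump_primitive_right e (1 * x + - _)) by lra. ring.
Qed.

Lemma dipole_test_function e p q : 0 < e ->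
  test_function (Rmin p q - e) (Rmax p q + e) (dipole e p q).
Proof.
  intros he. split.
  - intros n. apply smooth_upto_ex_derive_n.
    destruct n as [|n]; [exact I|].
    eexists. split; [apply is_derive_dipole|].
    apply smooth_upto_plus.
    + apply (smooth_upto_comp_lin n (bump e)), smooth_upto_bump.
    + apply (smooth_upto_mult n (fun _ => -1)); [apply smooth_upto_const|].
      apply (smooth_upto_comp_lin n (bump e)), smooth_upto_bump.
  - intros x hx. apply dipole_outside; lra.
Qed.

(** * The lemma of du Bois-Reymond *)

Lemma test_function_derives (a b : R) (phi : R -> R) :
  test_function a b phi ->
  (forall x, is_derive phi x (Derive phi x)) /\
  (forall x, is_derive (Derive phi) x (Derive_n phi 2 x)) /\
  (forall x, continuous (Derive_n phi 2) x).
Proof.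
  intros [h _]. split; [|split]; intros x.
  - apply Derive_correct. exact (h 1%nat x).
  - apply Derive_correct. exact (h 2%nat x).
  - apply (ex_derive_continuous (V := R_NormedModule)). exact (h 3%nat x).
Qed.

Lemma zero_of_zero_left (f : R -> R) (a : R) :
  continuous f a -> (forall x, x < a -> f x = 0) -> f a = 0.
Proof.
  intros hc h. apply NNPP. intros e.
  destruct (hc (fun y => y <> 0)) as [eps he]; [apply open_neq; exact e|].
  pose proof (cond_pos eps) as hep.
  apply (he (a - eps / 2)); [|apply h; lra].
  change (Rabs (a - eps / 2 - a) < eps). rewrite Rabs_left; lra.
Qed.

Lemma zero_of_zero_right (f : R -> R) (a : R) :
  continuous f a -> (forall x, a < x -> f x = 0) -> f a = 0.
Proof.
  intros hc h. apply NNPP. intros e.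
  destruct (hc (fun y => y <> 0)) as [eps he]; [apply open_neq; exact e|].
  pose proof (cond_pos eps) as hep.
  apply (he (a + eps / 2)); [|apply h; lra].
  change (Rabs (a + eps / 2 - a) < eps). rewrite Rabs_right; lra.
Qed.

(** Vanishing is prescribed only outside [a, b]; continuity carries it to the end points, which
    removes the boundary terms of integrations by parts. *)
Lemma test_function_boundary (a b : R) (phi : R -> R) :
  test_function a b phi ->
  phi a = 0 /\ phi b = 0 /\ Derive phi a = 0 /\ Derive phi b = 0.
Proof.
  intros htf. destruct (test_function_derives a b phi htf) as [d1 [d2 _]].
  destruct htf as [_ h].
  assert (c1 : forall x, continuous phi x)
    by (intros x; exact (continuous_of_is_derive _ _ _ (d1 x))).
  assert (c2 : forall x, continuous (Derive phi) x)
    by (intros x; exact (continuous_of_is_derive _ _ _ (d2 x))).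
  repeat split.
  - apply zero_of_zero_left; auto.
  - apply zero_of_zero_right; auto.
  - apply zero_of_zero_left; auto. intros x hx.
    apply is_derive_unique, (is_derive_ext_loc (fun _ => 0)).
    + apply (filter_imp (fun y => y < a)); [|apply open_lt; exact hx].
      intros y hy. symmetry. auto.
    + apply (is_derive_const (V := R_NormedModule)).
  - apply zero_of_zero_right; auto. intros x hx.
    apply is_derive_unique, (is_derive_ext_loc (fun _ => 0)).
    + apply (filter_imp (fun y => b < y)); [|apply open_gt; exact hx].
      intros y hy. symmetry. auto.
    + apply (is_derive_const (V := R_NormedModule)).
Qed.

(** The primitive is nondecreasing and 0 at both ends, so it vanishes on [a, b] and so does its
    derivative at p. *)
Lemma nonneg_integral_0 (f : R -> R) (a b p : R) :
  (forall x, continuous f x) -> (forall x, 0 <= f x) ->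
  is_RInt f a b 0 -> a < p < b -> f p = 0.
Proof.
  intros hc h0 hI hp.
  assert (hex : forall a b, ex_RInt f a b)
    by (intros; apply ex_RInt_of_continuous, hc).
  assert (hd : forall x, is_derive (fun y => RInt f a y) x (f x))
    by (intros; apply is_derive_RInt_upper; auto).
  assert (hmono : forall x y, x <= y -> RInt f a x <= RInt f a y).
  { intros x y hxy. apply (nondecreasing_of_derive _ f); auto.
    intros t. exact (continuous_of_is_derive _ _ _ (hd t)). }
  assert (hz : forall x, a <= x <= b -> RInt f a x = 0).
  { intros x hx. pose proof (hmono a x ltac:(lra)) as h1.
    pose proof (hmono x b ltac:(lra)) as h2.
    rewrite (is_RInt_unique f a b 0 hI) in h2.
    rewrite RInt_point in h1.
    change (@zero R_CompleteNormedModule) with 0 in h1.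
    lra. }
  rewrite <- (is_derive_unique _ _ _ (hd p)).
  apply is_derive_unique.
  apply (is_derive_ext_loc (fun _ => 0)).
  - apply (filter_imp (fun y => a < y /\ y < b)).
    + intros y hy. symmetry. apply hz. lra.
    + apply filter_and; [apply open_gt|apply open_lt]; lra.
  - apply (is_derive_const (V := R_NormedModule)).
Qed.

(** If w p < w q, let m be their mean and psi the derivative of a narrow dipole. Then (m - w) psi is
    nonnegative near both points and 0 elsewhere, has integral 0 since psi and w psi do, and yet is
    positive at p. *)
Lemma constant_of_weak_derivative_0 (w : R -> R) :
  (forall x, continuous w x) ->
  (forall a b phi, a <= b -> test_function a b phi ->
     is_RInt (fun x => w x * Derive phi x) a b 0) ->
  forall p q, w p = w q.
Proof.
  intros hw H.
  assert (K : forall p q, ~ w p < w q).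
  { intros p q hlt. set (m := (w p + w q) / 2).
    destruct (hw p (fun y => y < m)) as [e1 he1].
    { apply open_lt. unfold m. lra. }
    destruct (hw q (fun y => m < y)) as [e2 he2].
    { apply open_gt. unfold m. lra. }
    set (e := Rmin e1 e2).
    assert (he : 0 < e) by (apply Rmin_glb_lt; apply cond_pos).
    assert (hp : forall y, Rabs (y - p) < e -> w y < m).
    { intros y hy. apply he1. apply Rlt_le_trans with e;
        [exact hy|apply Rmin_l]. }
    assert (hq : forall y, Rabs (y - q) < e -> m < w y).
    { intros y hy. apply he2. apply Rlt_le_trans with e;
        [exact hy|apply Rmin_r]. }
    set (a := Rmin p q - e). set (b := Rmax p q + e).
    pose proof (Rmin_l p q). pose proof (Rmin_r p q).
    pose proof (Rmax_l p q). pose proof (Rmax_r p q).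
    set (psi := fun x => bump e (1 * x + - p) + -1 * bump e (1 * x + - q)).
    assert (hpsi : forall x, continuous psi x).
    { destruct (smooth_upto_plus 1
        (fun x => bump e (1 * x + - p)) (fun x => -1 * bump e (1 * x + - q))
        (smooth_upto_comp_lin 1 _ _ _ (smooth_upto_bump 1 e))
        (smooth_upto_mult 1 (fun _ => -1) _ (smooth_upto_const 1 (-1))
          (smooth_upto_comp_lin 1 _ _ _ (smooth_upto_bump 1 e))))
        as [d [h _]].
      intros x. exact (continuous_of_is_derive _ _ _ (h x)). }
    assert (hD : forall x, Derive (dipole e p q) x = psi x)
      by (intros; apply is_derive_unique, is_derive_dipole).
    assert (I1 : is_RInt (fun x => w x * psi x) a b 0).
    { apply (is_RInt_ext (fun x => w x * Derive (dipole e p q) x)).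
      - intros x _. rewrite hD. reflexivity.
      - apply H.
        + unfold a, b. lra.
        + apply dipole_test_function, he. }
    assert (I2 : is_RInt psi a b 0).
    { replace 0 with (dipole e p q b - dipole e p q a).
      - apply is_RInt_derive_piecewise.
        + intros x.
          exact (continuous_of_is_derive _ _ _ (is_derive_dipole e p q x)).
        + apply piecewise_continuous_of_continuous, hpsi.
        + intros x _. apply is_derive_dipole.
      - rewrite !dipole_outside; try ring; auto; unfold a, b; lra. }
    assert (I3 : is_RInt (fun x => (m - w x) * psi x) a b 0).
    { replace 0 with (m * 0 - 0) by ring.
      apply (is_RInt_ext (fun x => m * psi x - w x * psi x)).
      - intros; simpl. ring.
      - apply (is_RInt_minus (V := R_NormedModule)); [|exact I1].
        apply (is_RInt_scal (V := R_NormedModule)), I2. }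
    assert (sgn : forall x, 0 <= (m - w x) * bump e (1 * x + - p) /\
      0 <= (m - w x) * (-1 * bump e (1 * x + - q))).
    { intros x. split.
      - destruct (Rlt_dec (Rabs (x - p)) e) as [h|h].
        + pose proof (hp x h). pose proof (bump_nonneg e (1 * x + - p)). nra.
        + rewrite bump_outside; [lra|].
          replace (1 * x + - p) with (x - p) by ring. lra.
      - destruct (Rlt_dec (Rabs (x - q)) e) as [h|h].
        + pose proof (hq x h). pose proof (bump_nonneg e (1 * x + - q)). nra.
        + rewrite bump_outside; [lra|].
          replace (1 * x + - q) with (x - q) by ring. lra. }
    assert (hzero : (m - w p) * psi p = 0).
    { apply (nonneg_integral_0 (fun x => (m - w x) * psi x) a b).
      - intros x. apply (continuous_mult (K := R_AbsRing)); [|apply hpsi].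
        apply (continuous_minus (V := R_NormedModule)); [|apply hw].
        apply continuous_const.
      - intros x. unfold psi. pose proof (sgn x). lra.
      - exact I3.
      - unfold a, b. lra. }
    unfold psi in hzero. pose proof (sgn p).
    assert (0 < (m - w p) * bump e (1 * p + - p)); [|lra].
    replace (1 * p + - p) with 0 by ring.
    apply Rmult_lt_0_compat; [unfold m; lra|apply bump_0_pos, he]. }
  intros p q. apply Rle_antisym; apply Rnot_lt_le, K.
Qed.

(** * Distributional and classical solutions *)

Lemma continuous_cube (u : R -> R) (x : R) :
  continuous u x -> continuous (fun t => u t ^ 3) x.
Proof.
  intros h. apply (continuous_comp u (fun y => y ^ 3)); [exact h|].
  apply (continuous_of_is_derive _ _ (3 * u x ^ 2)).
  auto_derive; auto; ring.
Qed.

Lemma reaction_piecewise_continuous (mu u : R -> R) :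
  is_step mu -> (forall x, continuous u x) ->
  piecewise_continuous (fun x => mu x * u x - u x ^ 3).
Proof.
  intros [m1 m2] hu.
  exists (fun x => u x - u x ^ 3), (fun x => - u x - u x ^ 3).
  repeat split; intros x.
  - apply (continuous_minus (V := R_NormedModule)); [apply hu|].
    apply continuous_cube, hu.
  - apply (continuous_minus (V := R_NormedModule)).
    + apply (continuous_opp (V := R_NormedModule)), hu.
    + apply continuous_cube, hu.
  - intros hx. rewrite m1 by exact hx. ring.
  - intros hx. rewrite m2 by exact hx. ring.
Qed.

Lemma classical_of_front (mu : R -> R) (c : R) (u : R -> R) :
  is_step mu -> front mu c u -> classical_front c u (Derive u).
Proof.
  intros hmu [hC [hdist [hb [hl1 hl2]]]].
  destruct (hC 0 ltac:(lra)) as [_ [hex [hcd _]]].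
  assert (hd : forall x, is_derive u x (Derive u x))
    by (intros; apply Derive_correct, hex).
  assert (hcu : forall x, continuous u x)
    by (intros x; exact (continuous_of_is_derive _ _ _ (hd x))).
  set (F := fun x => mu x * u x - u x ^ 3).
  assert (hF : piecewise_continuous F)
    by (apply reaction_piecewise_continuous; auto).
  assert (hexF : forall a b, ex_RInt F a b)
    by (intros; apply piecewise_continuous_ex_RInt, hF).
  set (H := fun x => RInt F 0 x).
  assert (hcH : forall x, continuous H x)
    by (intros; apply continuous_RInt_upper, hexF).
  assert (hdH : forall x, x <> 0 -> is_derive H x (F x)).
  { intros x hx. apply is_derive_RInt_upper; [exact hexF|].
    apply piecewise_continuous_off_0; auto. }
  (* The equation says that w has weak derivative 0. Once w is constant, u' = w - c u - H is
     differentiable off 0. *)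
  set (w := fun x => Derive u x + c * u x + H x).
  assert (hcw : forall x, continuous w x).
  { intros x. apply (continuous_plus (V := R_NormedModule)); [|apply hcH].
    apply (continuous_plus (V := R_NormedModule)); [apply hcd|].
    apply (continuous_scal_r (V := R_NormedModule)), hcu. }
  assert (hw : forall x y, w x = w y).
  { apply constant_of_weak_derivative_0; [exact hcw|].
    intros a b phi hab htf.
    destruct (test_function_derives a b phi htf) as [d1 [d2 c2]].
    assert (hcphi : forall x, continuous (Derive phi) x)
      by (intros x; exact (continuous_of_is_derive _ _ _ (d2 x))).
    destruct (test_function_boundary a b phi htf) as [ha [hb' [hda hdb]]].
    assert (I1 := hdist a b phi hab htf).
    (* This is the integral of (u phi' + H phi)'. Subtracting the distributional equation leaves
       exactly w phi'. *)
    assert (I2 : is_RInt (fun x => (Derive u x * Derive phi x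
        + u x * Derive_n phi 2 x) + (F x * phi x + H x * Derive phi x)) a b 0).
    { set (N := fun x => u x * Derive phi x + H x * phi x).
      replace 0 with (N b - N a).
      - apply is_RInt_derive_piecewise.
        + intros x. unfold N. apply (continuous_plus (V := R_NormedModule));
            apply (continuous_mult (K := R_AbsRing)); auto.
          exact (continuous_of_is_derive _ _ _ (d1 x)).
        + apply piecewise_continuous_plus.
          * apply piecewise_continuous_of_continuous. intros x.
            apply (continuous_plus (V := R_NormedModule));
              apply (continuous_mult (K := R_AbsRing)); auto.
          * apply piecewise_continuous_plus;
              apply piecewise_continuous_mult; auto;
              apply piecewise_continuous_of_continuous; auto.
            intros x. exact (continuous_of_is_derive _ _ _ (d1 x)).
        + intros x hx. apply (is_derive_plus (V := R_NormedModule)).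
          * apply (is_derive_mult (K := R_AbsRing) u (Derive phi)); auto.
            intros; apply Rmult_comm.
          * apply (is_derive_mult (K := R_AbsRing) H phi); auto.
            intros; apply Rmult_comm.
      - unfold N. rewrite ha, hb', hda, hdb. ring. }
    replace 0 with (0 - 0) by ring.
    apply (is_RInt_ext (fun x => ((Derive u x * Derive phi x
        + u x * Derive_n phi 2 x) + (F x * phi x + H x * Derive phi x)) -
        (u x * Derive_n phi 2 x - c * (u x * Derive phi x)
          + (mu x * u x - u x ^ 3) * phi x))).
    - intros x _. unfold w, F. apply Rminus_diag_uniq. ring.
    - apply (is_RInt_minus (V := R_NormedModule)); assumption. }
  assert (hdd : forall x, x <> 0 ->
    is_derive (Derive u) x (- c * Derive u x - F x)).
  { intros x hx.
    apply (is_derive_ext (fun t => w 0 - c * u t - H t)).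
    - intros t. rewrite (hw 0 t). unfold w.
      apply Rminus_diag_uniq. ring.
    - assert (a1 := hd x). assert (a2 := hdH x hx).
      auto_derive; [ex_derives|].
      rewrite (is_derive_unique (fun t : R => u t) _ _ a1),
        (is_derive_unique (fun t : R => H t) _ _ a2). ring. }
  destruct hmu as [m1 m2].
  split; [|split; [exact hb|split; assumption]].
  split; [exact hd|]. split; [exact hcd|]. split; intros x hx.
  - replace (- c * Derive u x - u x + u x ^ 3) with (- c * Derive u x - F x).
    + apply hdd. lra.
    + unfold F. rewrite m1 by exact hx. ring.
  - replace (- c * Derive u x + u x + u x ^ 3) with (- c * Derive u x - F x).
    + apply hdd. lra.
    + unfold F. rewrite m2 by exact hx. ring.
Qed.

(** The Hoelder condition with exponent 0 says that u' has bounded oscillation. *)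
Lemma front_derive_bounded (mu : R -> R) (c : R) (u : R -> R) :
  front mu c u -> exists M, forall x, - M <= Derive u x.
Proof.
  intros [hC _]. destruct (hC 0 ltac:(lra)) as [_ [_ [_ [K hK]]]].
  exists (Rabs K + Rabs (Derive u 0)). intros x.
  pose proof (Rabs_pos K). pose proof (Rle_abs (- Derive u 0)) as h0.
  rewrite Rabs_Ropp in h0.
  destruct (Req_dec x 0) as [->|hx]; [lra|].
  specialize (hK x 0 hx). rewrite Rpower_O in hK.
  - pose proof (Rle_abs (- (Derive u x - Derive u 0))) as h1.
    rewrite Rabs_Ropp in h1. pose proof (Rle_abs K). lra.
  - apply Rabs_pos_lt. lra.
Qed.

(** * First-order resolvents *)

(* [v] is the bounded solution of [v' = k v - h]; the integral form makes sense
   of the equation across the jumps of [h]. *)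
Definition right_resolvent (k : R) (h v : R -> R) : Prop :=
  (exists M, forall x, Rabs (v x) <= M) /\
  (forall x y, is_RInt (fun t => exp (- k * t) * h t) x y
                 (exp (- k * x) * v x - exp (- k * y) * v y)).

(* [v] is the bounded solution of [v' = - k v + h]. *)
Definition left_resolvent (k : R) (h v : R -> R) : Prop :=
  right_resolvent k (fun x => h (- x)) (fun x => v (- x)).

(** Comparing the integrals over [x, y] bounds e^(- k x) (v1 - v2)(x) by the same expression at y,
    which tends to 0 as y -> +oo because v1 and v2 are bounded. *)
Lemma right_resolvent_le (k : R) (h1 h2 v1 v2 : R -> R) :
  0 < k -> right_resolvent k h1 v1 -> right_resolvent k h2 v2 ->
  (forall x, h1 x <= h2 x) -> forall x, v1 x <= v2 x.
Proof.
  intros hk [[M1 b1] i1] [[M2 b2] i2] hle x.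
  apply Rnot_lt_le. intros hlt.
  set (g := exp (- k * x) * (v1 x - v2 x)).
  assert (hg : 0 < g) by (apply Rmult_lt_0_compat; [apply exp_pos|lra]).
  assert (hM : 0 <= M1 + M2).
  { pose proof (b1 0). pose proof (b2 0).
    pose proof (Rabs_pos (v1 0)). pose proof (Rabs_pos (v2 0)). lra. }
  destruct (exp_small_at_m_infty k (g / (M1 + M2 + 1)) (- x) hk)
    as [y [hy1 hy2]].
  { apply Rdiv_lt_0_compat; lra. }
  apply Rlt_div_r in hy2; [|lra].
  pose proof (is_RInt_le _ _ x (- y) _ _ ltac:(lra) (i1 x (- y)) (i2 x (- y)))
    as h.
  replace (- k * - y) with (k * y) in h by ring.
  assert (hle' : forall t, x < t < - y ->
    exp (- k * t) * h1 t <= exp (- k * t) * h2 t).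
  { intros t _. apply Rmult_le_compat_l; [left; apply exp_pos|apply hle]. }
  specialize (h hle'). unfold g in *.
  pose proof (b1 (- y)) as c1. pose proof (b2 (- y)) as c2.
  apply Rabs_le_between in c1. apply Rabs_le_between in c2.
  pose proof (exp_pos (k * y)).
  assert (exp (k * y) * (v1 (- y) - v2 (- y)) <= exp (k * y) * (M1 + M2 + 1)).
  { apply Rmult_le_compat_l; lra. }
  lra.
Qed.

Lemma left_resolvent_le (k : R) (h1 h2 v1 v2 : R -> R) :
  0 < k -> left_resolvent k h1 v1 -> left_resolvent k h2 v2 ->
  (forall x, h1 x <= h2 x) -> forall x, v1 x <= v2 x.
Proof.
  intros hk r1 r2 hle x.
  pose proof (right_resolvent_le k _ _ _ _ hk r1 r2
    (fun x => hle (- x)) (- x)) as h.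
  simpl in h. rewrite Ropp_involutive in h. exact h.
Qed.

Lemma is_derive_exp_primitive (k H x : R) : 0 < k ->
  is_derive (fun t => - (H / k) * exp (- k * t)) x (exp (- k * x) * H).
Proof. intros hk. auto_derive; auto. field. lra. Qed.

Lemma is_RInt_exp_decay (k H x y : R) : 0 < k ->
  is_RInt (fun t => exp (- k * t) * H) x y
    (exp (- k * x) * (H / k) - exp (- k * y) * (H / k)).
Proof.
  intros hk.
  replace (exp (- k * x) * (H / k) - exp (- k * y) * (H / k)) with
    (- (H / k) * exp (- k * y) - - (H / k) * exp (- k * x)) by ring.
  apply (is_RInt_derive_piecewise (fun t => - (H / k) * exp (- k * t))).
  - intros t.
    exact (continuous_of_is_derive _ _ _ (is_derive_exp_primitive k H t hk)).
  - apply piecewise_continuous_of_continuous. intros t.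
    apply (continuous_mult (K := R_AbsRing)); [apply continuous_exp_lin|].
    apply continuous_const.
  - intros t _. apply is_derive_exp_primitive, hk.
Qed.

Lemma right_resolvent_const (k H : R) : 0 < k ->
  right_resolvent k (fun _ => H) (fun _ => H / k).
Proof.
  intros hk. split.
  - exists (Rabs (H / k)). intros; lra.
  - intros x y. apply is_RInt_exp_decay, hk.
Qed.

Lemma right_resolvent_bounds (k H : R) (h v : R -> R) :
  0 < k -> right_resolvent k h v -> (forall x, 0 <= h x <= H) ->
  forall x, 0 <= v x <= H / k.
Proof.
  intros hk hr hb x. split.
  - replace 0 with (0 / k) by (field; lra).
    apply (right_resolvent_le k (fun _ => 0) h (fun _ => 0 / k) v hk); auto.
    + apply right_resolvent_const, hk.
    + apply hb.
  - apply (right_resolvent_le k h (fun _ => H) v (fun _ => H / k) hk); auto.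
    + apply right_resolvent_const, hk.
    + apply hb.
Qed.

Lemma left_resolvent_bounds (k H : R) (h v : R -> R) :
  0 < k -> left_resolvent k h v -> (forall x, 0 <= h x <= H) ->
  forall x, 0 <= v x <= H / k.
Proof.
  intros hk hr hb x. rewrite <- (Ropp_involutive x).
  apply (right_resolvent_bounds k H (fun x => h (- x)) (fun x => v (- x)));
    auto.
Qed.

(** The solution is e^(k x) times the integral of e^(- k t) h over [x, +oo). As h >= 0 the primitive
    V is nondecreasing, so its supremum L serves as its limit at +oo. *)
Lemma right_resolvent_exists (k H : R) (h : R -> R) :
  0 < k -> piecewise_continuous h -> (forall x, 0 <= h x <= H) ->
  exists v, right_resolvent k h v.
Proof.
  intros hk hp hb.
  set (f := fun t => exp (- k * t) * h t).
  assert (hex : forall a b, ex_RInt f a b).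
  { intros a b. apply piecewise_continuous_ex_RInt, piecewise_continuous_mult;
      [|exact hp].
    apply piecewise_continuous_of_continuous, continuous_exp_lin. }
  set (V := fun x => RInt f 0 x).
  assert (hV : forall x y, is_RInt f x y (V y - V x)).
  { intros x y. unfold V.
    rewrite <- (RInt_Chasles f 0 x y) by apply hex.
    replace (plus (RInt f 0 x) (RInt f x y) - RInt f 0 x) with (RInt f x y)
      by (apply Rminus_diag_uniq; unfold plus; simpl; ring).
    apply (RInt_correct (V := R_CompleteNormedModule)), hex. }
  assert (hbd : forall x y, x <= y ->
    0 <= V y - V x <= exp (- k * x) * (H / k) - exp (- k * y) * (H / k)).
  { intros x y hxy. split.
    - assert (i0 := is_RInt_exp_decay k 0 x y hk).
      replace (exp (- k * x) * (0 / k) - exp (- k * y) * (0 / k)) with 0 in i0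
        by (field; lra).
      apply (is_RInt_le _ _ x y _ _ hxy i0 (hV x y)).
      intros t _. apply Rmult_le_compat_l; [left; apply exp_pos|apply hb].
    - apply (is_RInt_le f (fun t => exp (- k * t) * H) x y); auto.
      + apply is_RInt_exp_decay, hk.
      + intros t _. apply Rmult_le_compat_l; [left; apply exp_pos|apply hb]. }
  assert (hH : 0 <= H / k).
  { apply Rdiv_le_0_compat; [|exact hk]. pose proof (hb 0). lra. }
  assert (hup : forall x y, V y <= V x + exp (- k * x) * (H / k)).
  { intros x y. pose proof (exp_pos (- k * x)). pose proof (exp_pos (- k * y)).
    destruct (Rle_dec x y) as [h1|h1].
    - pose proof (hbd x y h1). nra.
    - pose proof (hbd y x ltac:(lra)). nra. }
  destruct (completeness (fun r => exists x, r = V x)) as [L [hL1 hL2]].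
  { exists (V 0 + exp (- k * 0) * (H / k)). intros r [x ->]. apply hup. }
  { exists (V 0), 0. reflexivity. }
  exists (fun x => exp (k * x) * (L - V x)).
  assert (hinv : forall x, exp (- k * x) * exp (k * x) = 1).
  { intros x. rewrite <- exp_plus. replace (- k * x + k * x) with 0 by ring.
    apply exp_0. }
  split.
  - exists (H / k). intros x.
    assert (0 <= L - V x).
    { assert (V x <= L); [|lra]. apply hL1. exists x. reflexivity. }
    assert (L <= V x + exp (- k * x) * (H / k)).
    { apply hL2. intros r [y ->]. apply hup. }
    pose proof (exp_pos (k * x)).
    rewrite Rabs_right by (apply Rle_ge, Rmult_le_pos; lra).
    replace (H / k) with (exp (k * x) * (exp (- k * x) * (H / k))).
    + apply Rmult_le_compat_l; lra.
    + rewrite <- Rmult_assoc, (Rmult_comm (exp (k * x))), hinv. ring.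
  - intros x y. rewrite <- !Rmult_assoc, !hinv.
    replace (1 * (L - V x) - 1 * (L - V y)) with (V y - V x) by ring.
    apply hV.
Qed.

Lemma right_resolvent_translate (k s : R) (h v : R -> R) :
  right_resolvent k h v ->
  right_resolvent k (fun x => h (x + s)) (fun x => v (x + s)).
Proof.
  intros [[M b] i]. split; [exists M; intros; apply b|].
  intros x y.
  assert (e : forall t, exp (- k * t) = exp (k * s) * exp (- k * (t + s))).
  { intros t. rewrite <- exp_plus. f_equal. ring. }
  rewrite (e x), (e y).
  replace (exp (k * s) * exp (- k * (x + s)) * v (x + s)
    - exp (k * s) * exp (- k * (y + s)) * v (y + s))
    with (exp (k * s) * (exp (- k * (x + s)) * v (x + s)
      - exp (- k * (y + s)) * v (y + s))) by ring.
  apply (is_RInt_ext (fun t => exp (k * s) *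
    (1 * (exp (- k * (1 * t + s)) * h (1 * t + s))))).
  - intros t _. rewrite (e t), !Rmult_1_l. apply Rminus_diag_uniq. ring.
  - apply (is_RInt_scal (V := R_NormedModule)).
    apply (is_RInt_comp_lin (V := R_NormedModule)
      (fun t => exp (- k * t) * h t) 1 s x y).
    rewrite !Rmult_1_l. apply i.
Qed.

Lemma left_resolvent_translate (k s : R) (h v : R -> R) :
  left_resolvent k h v ->
  left_resolvent k (fun x => h (x + s)) (fun x => v (x + s)).
Proof.
  intros hr. unfold left_resolvent in *.
  replace (fun x => h (- x + s)) with (fun x => (fun y => h (- y)) (x + - s)).
  - replace (fun x => v (- x + s)) with (fun x => (fun y => v (- y)) (x + - s)).
    + exact (right_resolvent_translate k (- s) _ _ hr).
    + apply functional_extensionality. intros x. f_equal. ring.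
  - apply functional_extensionality. intros x. f_equal. ring.
Qed.

Lemma right_resolvent_formula (k : R) (h v : R -> R) :
  right_resolvent k h v ->
  forall x, v x = exp (k * x) * (v 0 - RInt (fun t => exp (- k * t) * h t) 0 x).
Proof.
  intros [_ i] x. rewrite (is_RInt_unique _ _ _ _ (i 0 x)).
  rewrite Rmult_0_r, exp_0.
  replace (v 0 - (1 * v 0 - exp (- k * x) * v x)) with (exp (- k * x) * v x)
    by ring.
  rewrite <- Rmult_assoc, <- exp_plus.
  replace (k * x + - k * x) with 0 by ring. rewrite exp_0. ring.
Qed.

Lemma right_resolvent_continuous (k : R) (h v : R -> R) :
  right_resolvent k h v -> forall x, continuous v x.
Proof.
  intros hr x.
  apply (continuous_ext (fun x => exp (k * x) *
    (v 0 - RInt (fun t => exp (- k * t) * h t) 0 x))).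
  - intros y. symmetry. apply (right_resolvent_formula k h v hr).
  - apply (continuous_mult (K := R_AbsRing)); [apply continuous_exp_lin|].
    apply (continuous_minus (V := R_NormedModule)); [apply continuous_const|].
    apply continuous_RInt_upper. intros a b. eexists. apply hr.
Qed.

Lemma right_resolvent_derive (k : R) (h v : R -> R) (x : R) :
  right_resolvent k h v -> continuous h x -> is_derive v x (k * v x - h x).
Proof.
  intros hr hc.
  set (V := fun x => RInt (fun t => exp (- k * t) * h t) 0 x).
  assert (a : is_derive V x (exp (- k * x) * h x)).
  { apply (is_derive_RInt_upper (fun t => exp (- k * t) * h t)).
    - intros a b. eexists. apply hr.
    - apply (continuous_mult (K := R_AbsRing)); [|exact hc].
      apply continuous_exp_lin. }
  apply (is_derive_ext (fun x => exp (k * x) * (v 0 - V x))).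
  - intros y. symmetry. apply (right_resolvent_formula k h v hr).
  - rewrite (right_resolvent_formula k h v hr x). fold (V x).
    auto_derive; [ex_derives|].
    rewrite (is_derive_unique (fun t : R => V t) _ _ a).
    replace (- k * x) with (- (k * x)) by ring. rewrite exp_Ropp. field.
    apply Rgt_not_eq, exp_pos.
Qed.

Lemma continuous_reflect (h : R -> R) (x : R) :
  continuous h (- x) -> continuous (fun t => h (- t)) x.
Proof.
  intros hc. apply (continuous_comp Ropp h); [|exact hc].
  apply (continuous_opp (V := R_NormedModule)), continuous_id.
Qed.

Lemma left_resolvent_derive (k : R) (h v : R -> R) (x : R) :
  left_resolvent k h v -> continuous h x -> is_derive v x (- k * v x + h x).
Proof.
  intros hr hc.
  assert (a : is_derive (fun t => v (- t)) (- x) (k * v (- - x) - h (- - x))).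
  { apply (right_resolvent_derive k (fun t => h (- t)) (fun t => v (- t)) _ hr).
    apply continuous_reflect. rewrite Ropp_involutive. exact hc. }
  rewrite Ropp_involutive in a.
  apply (is_derive_ext (fun t => (fun t => v (- t)) (- t))).
  - intros t. simpl. rewrite Ropp_involutive. reflexivity.
  - replace (- k * v x + h x) with (-1 * (k * v x - h x)) by ring.
    apply (is_derive_comp (V := R_NormedModule) (fun t => v (- t)) Ropp);
      [exact a|].
    auto_derive; auto; ring.
Qed.

Lemma left_resolvent_exists (k H : R) (h : R -> R) :
  0 < k -> (forall x, continuous h x) -> (forall x, 0 <= h x <= H) ->
  exists v, left_resolvent k h v.
Proof.
  intros hk hc hb.
  destruct (right_resolvent_exists k H (fun x => h (- x)) hk) as [v hv].
  - apply piecewise_continuous_of_continuous. intros x.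
    apply continuous_reflect, hc.
  - intros x. apply hb.
  - exists (fun x => v (- x)). unfold left_resolvent.
    replace (fun x => v (- - x)) with v; [exact hv|].
    apply functional_extensionality. intros x. rewrite Ropp_involutive.
    reflexivity.
Qed.

(** * The order-preserving map *)

(** The representative of [mu] used in the construction; the value -1 at 0 makes it nonincreasing on
    all of R. The resulting front is classical, hence a front for every [mu]. *)
Definition step (x : R) : R := if Rlt_dec x 0 then 1 else -1.

Lemma is_step_step : is_step step.
Proof. split; intros x hx; unfold step; destruct (Rlt_dec x 0); lra. Qed.

Lemma step_bounds x : -1 <= step x <= 1.
Proof. unfold step. destruct (Rlt_dec x 0); lra. Qed.

Lemma step_nonincreasing x y : x <= y -> step y <= step x.
Proof.
  intros h. unfold step. destruct (Rlt_dec x 0), (Rlt_dec y 0); lra.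
Qed.

(* The constant [2 * (2 + c)] makes [source] nondecreasing in [f], and
   [D^2 + c D - 2 (2 + c) = (D + (2 + c)) (D - 2)] splits the resolvent. *)
Definition source (c : R) (f : R -> R) (x : R) : R :=
  (2 * (2 + c) + step x) * f x - f x ^ 3.

Definition unit_valued (f : R -> R) : Prop := forall x, 0 <= f x <= 1.

(* [u'' + c u' - 2 (2 + c) u = - source c f], where [v = u' + (2 + c) u]. *)
Definition maps_to (c : R) (f v u : R -> R) : Prop :=
  right_resolvent 2 (source c f) v /\ left_resolvent (2 + c) v u.

Lemma source_piecewise_continuous c f :
  (forall x, continuous f x) -> piecewise_continuous (source c f).
Proof.
  intros hf.
  assert (h := piecewise_continuous_plus (fun x => (2 * (2 + c)) * f x)
    (fun x => step x * f x - f x ^ 3)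
    ltac:(apply piecewise_continuous_of_continuous; intros x;
          apply (continuous_scal_r (V := R_NormedModule)), hf)
    (reaction_piecewise_continuous step f is_step_step hf)).
  replace (source c f) with
    (fun x => (2 * (2 + c)) * f x + (step x * f x - f x ^ 3)); [exact h|].
  apply functional_extensionality. intros x. unfold source. ring.
Qed.

(** Two points are allowed so that one inequality serves both the comparison of functions, with x =
    y, and that of translates, where [step] helps. *)
Lemma source_le c (f1 f2 : R -> R) x y : 0 <= c ->
  0 <= f1 x -> f1 x <= f2 y -> f2 y <= 1 -> y <= x ->
  source c f1 x <= source c f2 y.
Proof.
  intros hc h1 h2 h3 hxy. unfold source.
  pose proof (step_nonincreasing y x hxy). pose proof (step_bounds x).
  set (a := f1 x) in *. set (b := f2 y) in *. set (s := step x) in *.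
  set (s' := step y) in *.
  (* With K = 2 (2 + c), the difference is (b - a) (K + s - (a^2 + a b + b^2)) + (s' - s) b, and K +
     s >= 3. *)
  assert (0 <= (b - a) * (3 - (a * a + a * b + b * b))).
  { apply Rmult_le_pos; nra. }
  assert (0 <= (b - a) * (2 * (2 + c) + s - 3)) by (apply Rmult_le_pos; nra).
  assert (0 <= (s' - s) * b) by (apply Rmult_le_pos; lra).
  nra.
Qed.

Lemma source_bounds c f : 0 <= c -> unit_valued f ->
  forall x, 0 <= source c f x <= 2 * (2 + c).
Proof.
  intros hc hf x. pose proof (hf x). split.
  - replace 0 with (source c (fun _ => 0) x) by (unfold source; simpl; ring).
    apply source_le; lra.
  - apply Rle_trans with (source c (fun _ => 1) x).
    + apply source_le; lra.
    + unfold source. pose proof (step_bounds x). simpl. lra.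
Qed.

Lemma maps_to_le c f1 v1 u1 f2 v2 u2 : 0 <= c ->
  unit_valued f1 -> unit_valued f2 ->
  maps_to c f1 v1 u1 -> maps_to c f2 v2 u2 ->
  (forall x, f1 x <= f2 x) -> forall x, u1 x <= u2 x.
Proof.
  intros hc b1 b2 [r1 l1] [r2 l2] hle.
  apply (left_resolvent_le (2 + c) v1 v2); auto; [lra|].
  apply (right_resolvent_le 2 (source c f1) (source c f2)); auto; [lra|].
  intros x. pose proof (b1 x). pose proof (b2 x). pose proof (hle x).
  apply source_le; lra.
Qed.

Lemma maps_to_exists c f : 0 <= c -> unit_valued f ->
  (forall x, continuous f x) -> exists v u, maps_to c f v u.
Proof.
  intros hc hb hf.
  destruct (right_resolvent_exists 2 (2 * (2 + c)) (source c f)) as [v hv].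
  - lra.
  - apply source_piecewise_continuous, hf.
  - apply source_bounds; auto.
  - destruct (left_resolvent_exists (2 + c) (2 * (2 + c) / 2) v) as [u hu].
    + lra.
    + apply (right_resolvent_continuous 2 (source c f)), hv.
    + apply (right_resolvent_bounds 2 _ (source c f)); auto; [lra|].
      apply source_bounds; auto.
    + exists v, u. split; assumption.
Qed.

Section MapsTo.

Variables (c : R) (f v u : R -> R).
Hypothesis hc : 0 <= c.
Hypothesis hf : unit_valued f.
Hypothesis hm : maps_to c f v u.

Lemma maps_to_bounds_v x : 0 <= v x <= 2 + c.
Proof.
  replace (2 + c) with (2 * (2 + c) / 2) by field.
  apply (right_resolvent_bounds 2 _ (source c f)); [lra|apply hm|].
  apply source_bounds; auto.
Qed.

Lemma maps_to_unit_valued : unit_valued u.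
Proof.
  intros x. replace 1 with ((2 + c) / (2 + c)) by (field; lra).
  apply (left_resolvent_bounds (2 + c) (2 + c) v); [lra|apply hm|].
  apply maps_to_bounds_v.
Qed.

Lemma maps_to_continuous_v x : continuous v x.
Proof. apply (right_resolvent_continuous 2 (source c f)), hm. Qed.

Lemma maps_to_derive x : is_derive u x (- (2 + c) * u x + v x).
Proof. apply left_resolvent_derive; [apply hm|apply maps_to_continuous_v]. Qed.

Lemma maps_to_continuous x : continuous u x.
Proof. exact (continuous_of_is_derive _ _ _ (maps_to_derive x)). Qed.

Lemma maps_to_slope x : - (2 + c) <= - (2 + c) * u x + v x <= 2 + c.
Proof.
  pose proof (maps_to_unit_valued x). pose proof (maps_to_bounds_v x). nra.
Qed.

Lemma maps_to_derive2 x : (forall y, continuous f y) -> x <> 0 ->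
  is_derive (fun t => - (2 + c) * u t + v t) x
    (- c * (- (2 + c) * u x + v x) + 2 * (2 + c) * u x - source c f x).
Proof.
  intros hcf hx.
  assert (a1 := maps_to_derive x).
  assert (a2 : is_derive v x (2 * v x - source c f x)).
  { apply right_resolvent_derive; [apply hm|].
    apply piecewise_continuous_off_0; [|exact hx].
    apply source_piecewise_continuous, hcf. }
  auto_derive; [ex_derives|].
  rewrite (is_derive_unique (fun t : R => u t) _ _ a1),
    (is_derive_unique (fun t : R => v t) _ _ a2). ring.
Qed.

End MapsTo.

(** * Subsolutions and the greatest fixed point *)

Definition lipschitz (L : R) (f : R -> R) : Prop :=
  forall x y, Rabs (f x - f y) <= L * Rabs (x - y).

Lemma lipschitz_of_derive_off_0 (L : R) (f df : R -> R) :
  (forall x, continuous f x) ->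
  (forall x, x <> 0 -> is_derive f x (df x)) ->
  (forall x, x <> 0 -> Rabs (df x) <= L) ->
  lipschitz L f.
Proof.
  intros hc hd hL.
  assert (H : forall a b, a <= b -> (b <= 0 \/ 0 <= a) ->
    Rabs (f b - f a) <= L * (b - a)).
  { intros a b hab hs. destruct (Req_dec a b) as [->|hne].
    - rewrite !Rminus_diag, Rabs_R0. lra.
    - destruct (mean_value f df a b) as [t [ht e]]; [lra| |auto|].
      + intros t ht. apply hd. lra.
      + rewrite e, Rabs_mult, (Rabs_right (b - a)) by lra.
        apply Rmult_le_compat_r; [lra|]. apply hL. lra. }
  assert (H' : forall a b, a <= b -> Rabs (f b - f a) <= L * (b - a)).
  { intros a b hab.
    destruct (Rle_dec b 0); [apply H; lra|].
    destruct (Rle_dec 0 a); [apply H; lra|].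
    pose proof (H a 0 ltac:(lra) ltac:(lra)).
    pose proof (H 0 b ltac:(lra) ltac:(lra)).
    replace (f b - f a) with ((f b - f 0) + (f 0 - f a)) by ring.
    pose proof (Rabs_triang (f b - f 0) (f 0 - f a)). lra. }
  intros x y. destruct (Rle_dec y x).
  - rewrite (Rabs_right (x - y)) by lra. apply H'. lra.
  - rewrite Rabs_minus_sym, (Rabs_left (x - y)) by lra.
    replace (- (x - y)) with (y - x) by ring. apply H'. lra.
Qed.

Lemma lipschitz_continuous (L : R) (f : R -> R) :
  0 < L -> lipschitz L f -> forall x, continuous f x.
Proof.
  intros hL h x. apply filterlim_locally. intros eps.
  assert (he : 0 < eps / L) by (apply Rdiv_lt_0_compat; [apply cond_pos|lra]).
  exists (mkposreal _ he). intros y hy.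
  change (Rabs (f y - f x) < eps).
  change (Rabs (y - x) < eps / L) in hy.
  apply Rlt_div_r in hy; [|lra]. pose proof (h y x). lra.
Qed.

(** Order-theoretic form: f lies below its image. The constant 2 + c is the one that every image
    satisfies, see [maps_to_lipschitz], and it passes to suprema. *)
Definition subsolution (c : R) (f : R -> R) : Prop :=
  unit_valued f /\ lipschitz (2 + c) f /\
  exists v u, maps_to c f v u /\ forall x, f x <= u x.

Lemma maps_to_lipschitz c f v u : 0 <= c -> unit_valued f ->
  maps_to c f v u -> lipschitz (2 + c) u.
Proof.
  intros hc hf hm.
  apply (lipschitz_of_derive_off_0 _ u (fun x => - (2 + c) * u x + v x)).
  - apply (maps_to_continuous c f v u hm).
  - intros x _. apply (maps_to_derive c f v u hm).
  - intros x _. apply Rabs_le. apply (maps_to_slope c f v u hc hf hm).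
Qed.

(** Monotonicity passes the inequality on to the image, and the image brings its own Lipschitz
    bound; this admits 0 and [hat] as starting points. *)
Lemma subsolution_image c f v u : 0 <= c -> unit_valued f ->
  maps_to c f v u -> (forall x, f x <= u x) -> subsolution c u.
Proof.
  intros hc hf hm hle.
  assert (hu := maps_to_unit_valued c f v u hc hf hm).
  split; [exact hu|].
  split; [exact (maps_to_lipschitz c f v u hc hf hm)|].
  destruct (maps_to_exists c u hc hu) as [v' [u' hm']].
  { apply (maps_to_continuous c f v u hm). }
  exists v', u'. split; [exact hm'|].
  exact (maps_to_le c f v u u v' u' hc hf hu hm hm' hle).
Qed.

(* Knaster-Tarski: the supremum of all subsolutions is a fixed point. *)
Lemma greatest_fixed_point c : 0 <= c ->
  exists v u, unit_valued u /\ maps_to c u v u /\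
    forall f, subsolution c f -> forall x, f x <= u x.
Proof.
  intros hc.
  assert (h0 : exists f, subsolution c f).
  { assert (hz : unit_valued (fun _ => 0)) by (intros x; lra).
    destruct (maps_to_exists c (fun _ => 0) hc hz) as [v [u hm]].
    { intros x. apply continuous_const. }
    exists u. apply (subsolution_image c (fun _ => 0) v u hc hz hm).
    intros x. apply (maps_to_unit_valued c _ v u hc hz hm). }
  destruct h0 as [f0 hf0].
  assert (hbd : forall x,
    bound (fun r => exists f, subsolution c f /\ r = f x)).
  { intros x. exists 1. intros r [f [hf ->]]. apply hf. }
  assert (hne : forall x, exists r, exists f, subsolution c f /\ r = f x).
  { intros x. exists (f0 x), f0. auto. }
  set (s := fun x => proj1_sig (completeness _ (hbd x) (hne x))).
  assert (hs1 : forall f x, subsolution c f -> f x <= s x).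
  { intros f x hf. unfold s. destruct (completeness _ _ _) as [m [h1 h2]].
    simpl. apply h1. exists f. auto. }
  assert (hs2 : forall x M, (forall f, subsolution c f -> f x <= M) ->
    s x <= M).
  { intros x M hM. unfold s. destruct (completeness _ _ _) as [m [h1 h2]].
    simpl. apply h2. intros r [f [hf ->]]. auto. }
  assert (hsb : unit_valued s).
  { intros x. split.
    - apply Rle_trans with (f0 x); [apply hf0|apply hs1, hf0].
    - apply hs2. intros f hf. apply hf. }
  assert (hsl : lipschitz (2 + c) s).
  { assert (H : forall x y, s x <= s y + (2 + c) * Rabs (x - y)).
    { intros x y. apply hs2. intros f hf.
      pose proof (proj1 (proj2 hf) x y) as h.
      apply Rabs_le_between in h. pose proof (hs1 f y hf). lra. }
    intros x y. apply Rabs_le. pose proof (H x y). pose proof (H y x).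
    rewrite (Rabs_minus_sym y x) in *. lra. }
  destruct (maps_to_exists c s hc hsb) as [v [u hm]].
  { apply (lipschitz_continuous (2 + c)); [lra|exact hsl]. }
  assert (hsu : forall x, s x <= u x).
  { intros x. apply hs2. intros f hf.
    destruct (proj2 (proj2 hf)) as [vf [uf [hmf hle]]].
    apply Rle_trans with (uf x); [apply hle|].
    apply (maps_to_le c f vf uf s v u); auto. apply hf. }
  assert (hus : subsolution c u)
    by (apply (subsolution_image c s v u); auto).
  assert (e : s = u).
  { apply functional_extensionality. intros x.
    apply Rle_antisym; [apply hsu|apply hs1, hus]. }
  rewrite e in *. exists v, u. split; [exact hsb|]. split; [exact hm|].
  intros f hf x. apply hs1, hf.
Qed.

(** The translate solves the translated problem, whose source has [step (x + s)] in place of the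
    larger [step x]; the image of the translate is therefore above it. *)
Lemma subsolution_translate c v u s : 0 <= c -> unit_valued u ->
  maps_to c u v u -> 0 <= s -> subsolution c (fun x => u (x + s)).
Proof.
  intros hc hu hm hs.
  assert (hb : unit_valued (fun x => u (x + s))) by (intros x; apply hu).
  split; [exact hb|]. split.
  { intros x y. replace (x - y) with (x + s - (y + s)) by ring.
    apply (maps_to_lipschitz c u v u hc hu hm). }
  destruct (maps_to_exists c _ hc hb) as [v' [u' hm']].
  { intros x. apply (continuous_comp (fun x => x + s) u).
    - apply (continuous_plus (V := R_NormedModule)); [apply continuous_id|].
      apply continuous_const.
    - apply (maps_to_continuous c u v u hm). }
  exists v', u'. split; [exact hm'|].
  apply (left_resolvent_le (2 + c) (fun x => v (x + s)) v'); [lra| |apply hm'|].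
  { apply left_resolvent_translate, hm. }
  apply (right_resolvent_le 2 (fun x => source c u (x + s))
    (source c (fun x => u (x + s)))); [lra| |apply hm'|].
  { apply right_resolvent_translate, hm. }
  intros x. pose proof (hu (x + s)). apply source_le; lra.
Qed.

(** * A subsolution of compact support *)

(** Just right of x the quotient dw t / (t - x) is close to l < 0, whereas a minimum at x would give
    some t with dw t >= 0 by the mean value theorem. *)
Lemma second_derivative_test (w dw : R -> R) (x b l : R) :
  (forall t, is_derive w t (dw t)) -> dw x = 0 -> is_derive dw x l ->
  l < 0 -> x < b -> ~ (forall t, x <= t <= b -> w x <= w t).
Proof.
  intros hd h0 hl hlneg hxb hmin.
  apply is_derive_Reals in hl.
  destruct (hl (- l / 2)) as [[eta heta] h]; [lra|]. simpl in h.
  set (y := x + Rmin (b - x) (eta / 2)).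
  assert (hy : x < y <= b /\ y < x + eta).
  { unfold y. pose proof (Rmin_l (b - x) (eta / 2)).
    pose proof (Rmin_r (b - x) (eta / 2)).
    assert (0 < Rmin (b - x) (eta / 2)) by (apply Rmin_glb_lt; lra). lra. }
  destruct (mean_value w dw x y) as [t [ht e]]; [lra|auto| |].
  { intros t _. exact (continuous_of_is_derive _ _ _ (hd t)). }
  pose proof (hmin y ltac:(lra)) as hwy.
  specialize (h (t - x) ltac:(lra)).
  rewrite Rabs_right in h by lra. specialize (h ltac:(lra)).
  replace (x + (t - x)) with t in h by ring. rewrite h0, Rminus_0_r in h.
  apply Rabs_lt_between in h.
  assert (ht0 : 0 <= dw t) by nra.
  assert (0 <= dw t / (t - x)) by (apply Rdiv_le_0_compat; lra).
  lra.
Qed.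

Section Hat.

Variable c : R.
Hypothesis hc : 0 <= c < 2.

(** [beta] is the coefficient left after removing e^(- c x / 2). The support has half-width 8 / beta
    and ends at -1, inside the region where the step is 1. Over it the exponential varies from its
    central value by a factor at most e^(8 / beta), as c / 2 < 1, and [amp] compensates to keep the
    weight below beta / 2. *)
Let beta := 1 - c * c / 4.
Let center := - (8 / beta) - 1.
Let amp := beta / 2 * exp (- (8 / beta)).

Definition hat_profile (x : R) : R := 1 - (beta / 8 * (x - center)) ^ 2.
Definition hat_weight (x : R) : R := amp * exp (- (c / 2) * (x - center)).
(** The untruncated function is smooth everywhere and agrees with [hat] on the support, so second
    derivatives can be used up to its ends. *)
Definition hat_smooth (x : R) : R := hat_weight x * hat_profile x ^ 2.
Definition hat (x : R) : R :=
  hat_weight x * ((hat_profile x + Rabs (hat_profile x)) / 2) ^ 2.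

Lemma beta_bounds : 0 < beta <= 1.
Proof. unfold beta. nra. Qed.

Lemma hat_profile_le_1 x : hat_profile x <= 1.
Proof.
  unfold hat_profile. pose proof (pow2_ge_0 (beta / 8 * (x - center))). lra.
Qed.

Lemma hat_weight_pos x : 0 < hat_weight x.
Proof.
  pose proof beta_bounds. unfold hat_weight, amp.
  repeat apply Rmult_lt_0_compat; try apply exp_pos; lra.
Qed.

Lemma hat_support x : 0 <= hat_profile x ->
  center - 8 / beta <= x <= center + 8 / beta.
Proof.
  intros h. pose proof beta_bounds as hb. unfold hat_profile in h.
  set (y := beta / 8 * (x - center)) in *.
  assert (hy : -1 <= y <= 1) by nra.
  assert (e : x = center + 8 / beta * y) by (unfold y; field; lra).
  assert (0 < 8 / beta) by (apply Rdiv_lt_0_compat; lra).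
  rewrite e. split; nra.
Qed.

Lemma hat_weight_le x : 0 <= hat_profile x -> hat_weight x <= beta / 2.
Proof.
  intros h. apply hat_support in h. pose proof beta_bounds.
  unfold hat_weight, amp. rewrite Rmult_assoc, <- exp_plus.
  rewrite <- (Rmult_1_r (beta / 2)) at 2.
  apply Rmult_le_compat_l; [lra|]. rewrite <- exp_0.
  apply exp_nondecreasing.
  assert (0 < 8 / beta) by (apply Rdiv_lt_0_compat; lra). nra.
Qed.

Lemma hat_inside x : 0 <= hat_profile x -> hat x = hat_smooth x.
Proof.
  intros h. unfold hat, hat_smooth. rewrite Rabs_right by lra. field.
Qed.

Lemma hat_outside x : hat_profile x <= 0 -> hat x = 0.
Proof.
  intros h. unfold hat. rewrite Rabs_left1 by lra. field.
Qed.

Lemma hat_unit_valued : unit_valued hat.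
Proof.
  intros x. destruct (Rle_dec 0 (hat_profile x)) as [h|h].
  - rewrite hat_inside by exact h. unfold hat_smooth.
    pose proof (hat_weight_pos x). pose proof (hat_weight_le x h).
    pose proof (hat_profile_le_1 x). pose proof beta_bounds.
    assert (0 <= hat_profile x ^ 2 <= 1) by nra. nra.
  - rewrite hat_outside by lra. lra.
Qed.

Lemma hat_profile_continuous x : continuous hat_profile x.
Proof.
  apply (ex_derive_continuous (V := R_NormedModule)).
  unfold hat_profile. auto_derive. exact I.
Qed.

Lemma hat_weight_continuous x : continuous hat_weight x.
Proof.
  apply (ex_derive_continuous (V := R_NormedModule)).
  unfold hat_weight. auto_derive. exact I.
Qed.

Lemma hat_continuous x : continuous hat x.
Proof.
  apply (continuous_mult (K := R_AbsRing)); [apply hat_weight_continuous|].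
  apply (continuous_comp (fun x => hat_profile x + Rabs (hat_profile x))
    (fun y => (y / 2) ^ 2)).
  - apply (continuous_plus (V := R_NormedModule)).
    + apply hat_profile_continuous.
    + apply continuous_Rabs_comp, hat_profile_continuous.
  - apply (ex_derive_continuous (V := R_NormedModule)). auto_derive. exact I.
Qed.

Definition hat_slope (x : R) : R :=
  hat_weight x * (- (c / 2) * hat_profile x ^ 2
    - 4 * (beta / 8) ^ 2 * (x - center) * hat_profile x).

(** Arranged so that adding c [hat_slope] + [hat_smooth] leaves weight times (q^2)'' + beta q^2,
    where q is the profile and (q^2)'' = (beta / 8)^2 (8 - 12 q). *)
Definition hat_slope2 (x : R) : R :=
  hat_weight x * ((beta / 8) ^ 2 * (8 - 12 * hat_profile x)
    + (1 - c * c / 4) * hat_profile x ^ 2) - c * hat_slope x - hat_smooth x.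

Lemma hat_smooth_derive x : is_derive hat_smooth x (hat_slope x).
Proof.
  unfold hat_smooth, hat_slope, hat_weight, hat_profile.
  auto_derive; auto. unfold Rdiv, Rminus. set (e := exp _). simpl. field.
Qed.

Lemma hat_slope_derive x : is_derive hat_slope x (hat_slope2 x).
Proof.
  unfold hat_slope2, hat_slope, hat_smooth, hat_weight, hat_profile.
  auto_derive; auto. unfold Rdiv, Rminus. set (e := exp _).
  clearbody beta center amp. simpl. field.
Qed.

(** Half of beta q^2 absorbs the cubic term because the weight is small; the other half absorbs
    (q^2)'', negative only for q > 2 / 3 and small because the hat is wide. *)
Lemma hat_smooth_subsolution x : 0 < hat_profile x ->
  0 <= hat_slope2 x + c * hat_slope x + hat_smooth x - hat_smooth x ^ 3.
Proof.
  intros hq. unfold hat_slope2. fold beta.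
  pose proof (hat_weight_pos x) as hw.
  pose proof (hat_weight_le x (Rlt_le _ _ hq)) as hw2.
  pose proof (hat_profile_le_1 x) as hq1. pose proof beta_bounds as hb.
  unfold hat_smooth. set (q := hat_profile x) in *.
  set (W := hat_weight x) in *.
  replace (W * ((beta / 8) ^ 2 * (8 - 12 * q) + beta * q ^ 2) - c * hat_slope x
    - W * q ^ 2 + c * hat_slope x + W * q ^ 2 - (W * q ^ 2) ^ 3)
    with (W * ((beta / 8) ^ 2 * (8 - 12 * q) + beta * q ^ 2
      - (W * W) * (q ^ 2 * (q ^ 2 * q ^ 2)))) by ring.
  apply Rmult_le_pos; [lra|].
  assert (h1 : W * W <= beta / 2) by nra.
  assert (h2 : 0 <= q ^ 2 <= 1) by nra.
  assert (h3 : 0 <= q ^ 2 * (q ^ 2 * q ^ 2) <= q ^ 2).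
  { assert (0 <= q ^ 2 * q ^ 2 <= 1) by nra. nra. }
  assert (h4 : (W * W) * (q ^ 2 * (q ^ 2 * q ^ 2)) <= beta / 2 * q ^ 2).
  { apply Rmult_le_compat; nra. }
  assert (h5 : 0 <= (beta / 8) ^ 2 * (8 - 12 * q) + beta / 2 * q ^ 2).
  { replace ((beta / 8) ^ 2 * (8 - 12 * q) + beta / 2 * q ^ 2)
      with (beta * (beta / 64 * (8 - 12 * q) + / 2 * q ^ 2)) by field.
    apply Rmult_le_pos; [lra|].
    destruct (Rle_dec q (2 / 3)); [nra|].
    assert (beta / 64 * (8 - 12 * q) >= - / 16) by nra. nra. }
  lra.
Qed.

(** Maximum principle: a negative minimum of w = u - [hat_smooth] over the support is interior,
    since [hat_smooth] vanishes at the ends and u >= 0. There w' = 0 and the equations give w'' <= 2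
    (2 + c) w < 0. *)
Lemma hat_le_image v u : maps_to c hat v u -> forall x, hat x <= u x.
Proof.
  intros hm x1. apply Rnot_lt_le. intros hlt.
  assert (hc0 : 0 <= c) by lra.
  pose proof beta_bounds as hb.
  assert (hR : 0 < 8 / beta) by (apply Rdiv_lt_0_compat; lra).
  assert (hu := maps_to_unit_valued c hat v u hc0 hat_unit_valued hm).
  assert (hin : forall x, u x < hat x -> 0 < hat_profile x).
  { intros x hx. apply Rnot_le_lt. intros hn.
    rewrite hat_outside in hx by exact hn. pose proof (hu x). lra. }
  set (w := fun x => u x - hat_smooth x).
  set (dw := fun x => (- (2 + c) * u x + v x) - hat_slope x).
  assert (hdw : forall x, is_derive w x (dw x)).
  { intros x. apply (is_derive_minus (V := R_NormedModule)).
    - apply (maps_to_derive c hat v u hm).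
    - apply hat_smooth_derive. }
  set (a := center - 8 / beta). set (b := center + 8 / beta).
  destruct (continuity_ab_min w a b) as [x [hmin hx]].
  { unfold a, b. lra. }
  { intros t _. apply continuity_pt_filterlim.
    exact (continuous_of_is_derive _ _ _ (hdw t)). }
  assert (hq1 := hin x1 hlt).
  assert (hwx : w x < 0).
  { apply Rle_lt_trans with (w x1).
    - apply hmin, hat_support. lra.
    - unfold w. rewrite <- hat_inside by lra. lra. }
  assert (hends : forall t, t = a \/ t = b -> hat_smooth t = 0).
  { intros t ht. unfold hat_smooth.
    replace (hat_profile t) with 0; [ring|].
    unfold hat_profile. destruct ht as [->| ->]; unfold a, b; field; lra. }
  assert (hx' : a < x < b).
  { unfold w in hwx. pose proof (hu x).
    destruct (Req_dec x a) as [e|e]; [rewrite (hends x) in hwx by auto; lra|].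
    destruct (Req_dec x b) as [e'|e']; [rewrite (hends x) in hwx by auto; lra|].
    lra. }
  assert (hq : 0 < hat_profile x).
  { assert (hy : -1 < beta / 8 * (x - center) < 1).
    { unfold a, b in hx'. split.
      - replace (-1) with (beta / 8 * - (8 / beta)) by (field; lra).
        apply Rmult_lt_compat_l; lra.
      - replace 1 with (beta / 8 * (8 / beta)) by (field; lra).
        apply Rmult_lt_compat_l; lra. }
    unfold hat_profile. nra. }
  assert (hx0 : x < 0).
  { unfold b, center in hx'. lra. }
  assert (hdw0 : dw x = 0).
  { assert (pr : derivable_pt w x).
    { exists (dw x). apply is_derive_Reals, hdw. }
    rewrite <- (derive_pt_eq_0 w x (dw x) pr)
      by (apply is_derive_Reals, hdw).
    apply (deriv_minimum w a b x pr); try lra.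
    intros t h1 h2. apply hmin. lra. }
  apply (second_derivative_test w dw x b
    ((- c * (- (2 + c) * u x + v x) + 2 * (2 + c) * u x - source c hat x)
      - hat_slope2 x)); auto; try lra.
  - apply (is_derive_minus (V := R_NormedModule)).
    + apply (maps_to_derive2 c hat v u hm); [apply hat_continuous|lra].
    + apply hat_slope_derive.
  - pose proof (hat_smooth_subsolution x hq) as hs.
    unfold source. rewrite hat_inside by lra.
    rewrite (proj1 is_step_step x hx0).
    unfold dw in hdw0. unfold w in hwx.
    set (d := - (2 + c) * u x + v x) in *.
    replace (hat_slope x) with d in hs by lra.
    set (S := hat_smooth x) in *.
    assert ((2 * (2 + c)) * (u x - S) < 0) by nra. lra.
  - intros t ht. apply hmin. lra.
Qed.

Lemma positive_subsolution : exists f x, subsolution c f /\ 0 < f x /\ x < 0.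
Proof.
  assert (hc0 : 0 <= c) by lra. pose proof beta_bounds.
  destruct (maps_to_exists c hat hc0 hat_unit_valued hat_continuous)
    as [v [u hm]].
  (* The image of the hat is taken because it carries the required Lipschitz constant. *)
  exists u, center. split; [|split].
  - apply (subsolution_image c hat v u hc0 hat_unit_valued hm).
    apply (hat_le_image v u hm).
  - apply Rlt_le_trans with (hat center); [|apply (hat_le_image v u hm)].
    assert (e : hat_profile center = 1) by (unfold hat_profile; ring).
    rewrite hat_inside by lra. unfold hat_smooth. rewrite e.
    pose proof (hat_weight_pos center). lra.
  - unfold center. assert (0 < 8 / beta) by (apply Rdiv_lt_0_compat; lra). lra.
Qed.

End Hat.

(** * Existence *)

Lemma fixed_point_classical (c : R) (u v : R -> R) :
  maps_to c u v u ->
  classical_solution c u (fun x => - (2 + c) * u x + v x).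
Proof.
  intros hm.
  assert (hcu := maps_to_continuous c u v u hm).
  assert (hcv := maps_to_continuous_v c u v u hm).
  split; [apply (maps_to_derive c u v u hm)|]. split; [|split].
  - intros x. apply (continuous_plus (V := R_NormedModule)); [|apply hcv].
    apply (continuous_scal_r (V := R_NormedModule)), hcu.
  - intros x hx.
    assert (h := maps_to_derive2 c u v u hm x hcu ltac:(lra)).
    unfold source in h. rewrite (proj1 is_step_step x hx) in h.
    replace (- c * (- (2 + c) * u x + v x) - u x + u x ^ 3) with
      (- c * (- (2 + c) * u x + v x) + 2 * (2 + c) * u x
        - ((2 * (2 + c) + 1) * u x - u x ^ 3)) by ring.
    exact h.
  - intros x hx.
    assert (h := maps_to_derive2 c u v u hm x hcu ltac:(lra)).
    unfold source in h. rewrite (proj2 is_step_step x hx) in h.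
    replace (- c * (- (2 + c) * u x + v x) + u x + u x ^ 3) with
      (- c * (- (2 + c) * u x + v x) + 2 * (2 + c) * u x
        - ((2 * (2 + c) + -1) * u x - u x ^ 3)) by ring.
    exact h.
Qed.

Section Limits.

Variables (c M : R) (u du : R -> R).
Hypothesis hc : 0 <= c.
Hypothesis hu : unit_valued u.
Hypothesis hM : forall x, Rabs (du x) <= M.
Hypothesis hs : classical_solution c u du.
Hypothesis hanti : forall x y, x <= y -> u y <= u x.

(** The equation reads Q' = - (mu u - u^3). As Q is bounded, the reaction term cannot stay away from
    0 on a half-line, which determines the limits. *)
Let Q (x : R) : R := du x + c * u x.

Lemma momentum_continuous x : continuous Q x.
Proof.
  apply (continuous_plus (V := R_NormedModule)); [apply hs|].
  apply (continuous_scal_r (V := R_NormedModule)).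
  exact (continuous_of_is_derive _ _ _ (proj1 hs x)).
Qed.

Lemma momentum_bounds x : - M <= Q x <= M + c.
Proof.
  pose proof (hM x) as h. apply Rabs_le_between in h. pose proof (hu x).
  unfold Q. nra.
Qed.

Lemma bound_nonneg : 0 <= M.
Proof. pose proof (hM 0). pose proof (Rabs_pos (du 0)). lra. Qed.

Lemma momentum_derive_neg x : x < 0 -> is_derive Q x (- (u x * (1 - u x ^ 2))).
Proof.
  intros hx. assert (a1 := proj1 hs x).
  assert (a2 := proj1 (proj2 (proj2 hs)) x hx).
  unfold Q. auto_derive; [ex_derives|].
  rewrite (is_derive_unique (fun t : R => u t) _ _ a1),
    (is_derive_unique (fun t : R => du t) _ _ a2). ring.
Qed.

Lemma momentum_derive_pos x : 0 < x -> is_derive Q x (u x * (1 + u x ^ 2)).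
Proof.
  intros hx. assert (a1 := proj1 hs x).
  assert (a2 := proj2 (proj2 (proj2 hs)) x hx).
  unfold Q. auto_derive; [ex_derives|].
  rewrite (is_derive_unique (fun t : R => u t) _ _ a1),
    (is_derive_unique (fun t : R => du t) _ _ a2). ring.
Qed.

Lemma eventually_small e : 0 < e -> exists X, u X < e.
Proof.
  intros he. apply NNPP. intros hn.
  assert (hge : forall x, e <= u x).
  { intros x. apply Rnot_lt_le. intros h. apply hn. exists x. exact h. }
  pose proof bound_nonneg.
  (* Over this length Q would gain 2 M + c + 1, more than the width 2 M + c of its range. *)
  set (y := (2 * M + c + 1) / e).
  assert (hy : 0 < y) by (apply Rdiv_lt_0_compat; lra).
  assert (ey : e * y = 2 * M + c + 1) by (unfold y; field; lra).
  destruct (mean_value Q (fun x => u x * (1 + u x ^ 2)) 0 y) as [t [ht et]];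
    auto.
  - intros x hx. apply momentum_derive_pos. lra.
  - intros x _. apply momentum_continuous.
  - pose proof (momentum_bounds 0). pose proof (momentum_bounds y).
    pose proof (hge t).
    assert (e <= u t * (1 + u t ^ 2)) by nra. nra.
Qed.

Lemma eventually_large x0 e : x0 < 0 -> 0 < u x0 -> 0 < e ->
  exists X, 1 - e < u X.
Proof.
  intros hx0 hp he. apply NNPP. intros hn.
  assert (hle : forall x, u x <= 1 - e).
  { intros x. apply Rnot_lt_le. intros h. apply hn. exists x. exact h. }
  pose proof bound_nonneg.
  (* Left of x0, u >= u x0 by monotonicity and 1 - u^2 >= 1 - u >= e, so m bounds the reaction term
     from below. *)
  set (m := u x0 * e).
  assert (hm : 0 < m) by (apply Rmult_lt_0_compat; lra).
  set (y := (2 * M + c + 1) / m).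
  assert (hy : 0 < y) by (apply Rdiv_lt_0_compat; lra).
  assert (ey : m * y = 2 * M + c + 1) by (unfold y; field; lra).
  destruct (mean_value Q (fun x => - (u x * (1 - u x ^ 2))) (x0 - y) x0)
    as [t [ht et]]; [lra| | |].
  - intros x hx. apply momentum_derive_neg. lra.
  - intros x _. apply momentum_continuous.
  - pose proof (momentum_bounds (x0 - y)). pose proof (momentum_bounds x0).
    pose proof (hle t). pose proof (hanti t x0 ltac:(lra)). pose proof (hu t).
    assert (m <= u t * (1 - u t ^ 2)).
    { unfold m. apply Rmult_le_compat; nra. }
    nra.
Qed.

Lemma limit_p_infty : is_lim u p_infty 0.
Proof.
  apply is_lim_spec. intros eps.
  destruct (eventually_small eps (cond_pos eps)) as [X hX].
  exists X. intros x hx. pose proof (hanti X x ltac:(lra)). pose proof (hu x).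
  rewrite Rminus_0_r, Rabs_right; lra.
Qed.

Lemma limit_m_infty x0 : x0 < 0 -> 0 < u x0 -> is_lim u m_infty 1.
Proof.
  intros hx0 hp. apply is_lim_spec. intros eps.
  destruct (eventually_large x0 eps hx0 hp (cond_pos eps)) as [X hX].
  exists X. intros x hx. pose proof (hanti x X ltac:(lra)). pose proof (hu x).
  rewrite Rabs_left1; lra.
Qed.

End Limits.

(** The derivative of e^((2 + c) x) u is e^((2 + c) x) v >= 0, so positivity propagates to the
    right. *)
Lemma fixed_point_positive (c : R) (u v : R -> R) (x0 : R) :
  0 <= c -> unit_valued u -> maps_to c u v u ->
  0 < u x0 -> forall x, x0 <= x -> 0 < u x.
Proof.
  intros hc hu hm hp x hx.
  assert (h : exp ((2 + c) * x0) * u x0 <= exp ((2 + c) * x) * u x).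
  { apply (nondecreasing_of_derive (fun t => exp ((2 + c) * t) * u t)
      (fun t => exp ((2 + c) * t) * v t)).
    - exact hx.
    - intros t _. assert (a := maps_to_derive c u v u hm t).
      auto_derive; [ex_derives|].
      rewrite (is_derive_unique (fun t : R => u t) _ _ a). ring.
    - intros t. apply (continuous_mult (K := R_AbsRing)).
      + apply continuous_exp_lin.
      + apply (maps_to_continuous c u v u hm).
    - intros t _. apply Rmult_le_pos; [left; apply exp_pos|].
      apply (maps_to_bounds_v c u v u hc hu hm). }
  pose proof (exp_pos ((2 + c) * x0)). pose proof (exp_pos ((2 + c) * x)).
  assert (0 < exp ((2 + c) * x0) * u x0) by nra. nra.
Qed.

(* If [u] reaches 1, then [v] is extremal there, hence everywhere to the right,
   and [u] cannot decrease. *)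
Lemma fixed_point_lt_1 (c : R) (u v : R -> R) (X : R) :
  0 <= c -> unit_valued u -> maps_to c u v u ->
  (forall x y, x <= y -> u y <= u x) -> u X < 1 -> forall x, u x < 1.
Proof.
  intros hc hu hm hanti hX x1. apply Rnot_le_lt. intros h1.
  assert (h1' : forall x, x <= x1 -> u x = 1).
  { intros x hx. pose proof (hanti x x1 hx). pose proof (hu x). lra. }
  set (x2 := x1 - 1).
  assert (hv2 : v x2 = 2 + c).
  { assert (e : - (2 + c) * u x2 + v x2 = 0).
    { rewrite <- (is_derive_unique _ _ _ (maps_to_derive c u v u hm x2)).
      apply is_derive_unique, (is_derive_ext_loc (fun _ => 1)).
      - apply (filter_imp (fun y => y < x1)).
        + intros y hy. symmetry. apply h1'. lra.
        + apply open_lt. unfold x2. lra.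
      - apply (is_derive_const (V := R_NormedModule)). }
    rewrite (h1' x2) in e by (unfold x2; lra). lra. }
  assert (hv : forall y, x2 <= y -> 2 + c <= v y).
  { intros y hy. destruct (proj1 hm) as [_ hi].
    pose proof (is_RInt_le _ _ x2 y _ _ hy (hi x2 y)
      (is_RInt_exp_decay 2 (2 * (2 + c)) x2 y ltac:(lra))) as h.
    assert (hle : forall t, x2 < t < y ->
      exp (- (2) * t) * source c u t <= exp (- (2) * t) * (2 * (2 + c))).
    { intros t _. apply Rmult_le_compat_l; [left; apply exp_pos|].
      apply source_bounds; auto. }
    specialize (h hle). rewrite hv2 in h.
    replace (2 * (2 + c) / 2) with (2 + c) in h by field.
    pose proof (exp_pos (- (2) * y)). nra. }
  set (y := Rmax X x2).
  assert (hy1 : X <= y) by apply Rmax_l.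
  assert (hy2 : x2 <= y) by apply Rmax_r.
  assert (h : u x2 <= u y).
  { apply (nondecreasing_of_derive u (fun x => - (2 + c) * u x + v x)).
    - exact hy2.
    - intros t _. apply (maps_to_derive c u v u hm).
    - apply (maps_to_continuous c u v u hm).
    - intros t ht. pose proof (hv t ltac:(lra)). pose proof (hu t). nra. }
  rewrite (h1' x2) in h by (unfold x2; lra).
  pose proof (hanti X y hy1). lra.
Qed.

Lemma classical_front_exists (c : R) : 0 <= c < 2 ->
  exists u du M, classical_front c u du /\ forall x, Rabs (du x) <= M.
Proof.
  intros hc. assert (hc0 : 0 <= c) by lra.
  destruct (greatest_fixed_point c hc0) as [v [u [hu [hm hmax]]]].
  set (du := fun x => - (2 + c) * u x + v x).
  assert (hs : classical_solution c u du) by (apply fixed_point_classical, hm).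
  assert (hM : forall x, Rabs (du x) <= 2 + c).
  { intros x. apply Rabs_le. apply (maps_to_slope c u v u hc0 hu hm). }
  assert (hanti : forall x y, x <= y -> u y <= u x).
  { intros x y hxy. replace y with (x + (y - x)) by ring.
    apply (hmax (fun t => u (t + (y - x)))).
    apply (subsolution_translate c v u); auto. lra. }
  destruct (positive_subsolution c hc) as [f [x0 [hf [hfx hx0]]]].
  assert (hux : 0 < u x0) by (pose proof (hmax f hf x0); lra).
  (* A point with u < 1, from which [fixed_point_lt_1] gets the strict bound everywhere. *)
  destruct (eventually_small c (2 + c) u du hc0 hu hM hs 1) as [X hX]; [lra|].
  exists u, du, (2 + c). split; [|exact hM].
  split; [exact hs|]. split; [|split].
  - intros x. split.
    + destruct (Rle_dec x0 x) as [h|h].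
      * apply (fixed_point_positive c u v x0); auto.
      * pose proof (hanti x x0 ltac:(lra)). lra.
    + apply (fixed_point_lt_1 c u v X); auto.
  - apply (limit_m_infty c (2 + c) u du hc0 hu hM hs hanti x0 hx0 hux).
  - apply (limit_p_infty c (2 + c) u du hc0 hu hM hs hanti).
Qed.

(** * From classical fronts back to distributional ones *)

(** With this bound a bounded Lipschitz function is Hoelder for all these exponents: the Lipschitz
    estimate serves distances up to 1, the bound larger ones. *)
Lemma Rpower_lower (z alpha : R) : 0 < z -> 0 <= alpha < 1 ->
  Rmin z 1 <= Rpower z alpha.
Proof.
  intros hz ha. unfold Rpower. destruct (Rle_dec z 1) as [h|h].
  - apply Rle_trans with z; [apply Rmin_l|].
    rewrite <- (exp_ln z) at 1 by exact hz. apply exp_nondecreasing.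
    assert (ln z <= 0); [|nra]. rewrite <- ln_1. apply ln_le; lra.
  - apply Rle_trans with 1; [apply Rmin_r|].
    rewrite <- exp_0. apply exp_nondecreasing.
    assert (0 <= ln z); [|nra]. rewrite <- ln_1. apply ln_le; lra.
Qed.

Lemma front_of_classical (mu : R -> R) (c M : R) (u du : R -> R) :
  is_step mu -> 0 <= c -> classical_front c u du ->
  (forall x, Rabs (du x) <= M) -> front mu c u.
Proof.
  intros hmu hc [hs [hb [hl1 hl2]]] hM.
  assert (eD : Derive u = du).
  { apply functional_extensionality. intros x. apply is_derive_unique, hs. }
  assert (hcu : forall x, continuous u x)
    by (intros x; exact (continuous_of_is_derive _ _ _ (proj1 hs x))).
  assert (hcd : forall x, continuous du x) by apply hs.
  assert (hM0 : 0 <= M).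
  { pose proof (hM 0). pose proof (Rabs_pos (du 0)). lra. }
  assert (hdd : forall x, x <> 0 ->
    is_derive du x (- c * du x - (mu x * u x - u x ^ 3))).
  { intros x hx. destruct (Rlt_dec x 0) as [h|h].
    - rewrite (proj1 hmu x h).
      replace (- c * du x - (1 * u x - u x ^ 3))
        with (- c * du x - u x + u x ^ 3) by ring.
      apply hs, h.
    - rewrite (proj2 hmu x) by lra.
      replace (- c * du x - (-1 * u x - u x ^ 3))
        with (- c * du x + u x + u x ^ 3) by ring.
      apply hs. lra. }
  (* Off 0 the equation bounds u'' by c M + |mu u| + u^3 <= c M + 2. *)
  assert (hlip : lipschitz (c * M + 2) du).
  { apply (lipschitz_of_derive_off_0 _ du
      (fun x => - c * du x - (mu x * u x - u x ^ 3))); auto.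
    intros x hx. pose proof (hb x).
    assert (hmux : -1 <= mu x <= 1).
    { destruct (Rlt_dec x 0); [rewrite (proj1 hmu x)|rewrite (proj2 hmu x)];
        lra. }
    pose proof (hM x) as h. apply Rabs_le_between in h.
    assert (0 <= u x ^ 3 <= 1).
    { assert (0 <= u x * u x <= 1) by nra. simpl. nra. }
    apply Rabs_le. nra. }
  split; [|split; [|split; [exact hb|split; assumption]]].
  - intros alpha ha. split; [exact hb|]. split; [|split].
    + intros x. exists (du x). apply hs.
    + rewrite eD. exact hcd.
    + exists (c * M + 2 + 2 * M). intros x y hxy. rewrite eD.
      assert (hz : 0 < Rabs (x - y)) by (apply Rabs_pos_lt; lra).
      pose proof (Rpower_lower (Rabs (x - y)) alpha hz ha) as hp.
      assert (hcM : 0 <= c * M) by (apply Rmult_le_pos; lra).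
      revert hp. unfold Rmin. destruct (Rle_dec (Rabs (x - y)) 1); intros hp.
      * apply Rle_trans with ((c * M + 2) * Rabs (x - y)); [apply hlip|].
        apply Rmult_le_compat; lra.
      * pose proof (Rabs_triang (du x) (- du y)) as ht.
        rewrite Rabs_Ropp in ht. pose proof (hM x). pose proof (hM y).
        apply Rle_trans with ((c * M + 2 + 2 * M) * 1); [unfold Rminus; lra|].
        apply Rmult_le_compat_l; lra.
  - intros a b phi hab htf. rewrite <- eD in *.
    destruct (test_function_derives a b phi htf) as [d1 [d2 c2]].
    destruct (test_function_boundary a b phi htf) as [ha [hb' [hda hdb]]].
    assert (c0 : forall x, continuous phi x)
      by (intros x; exact (continuous_of_is_derive _ _ _ (d1 x))).
    assert (c1 : forall x, continuous (Derive phi) x)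
      by (intros x; exact (continuous_of_is_derive _ _ _ (d2 x))).
    (* By the classical equation, the derivative of N off 0 is the integrand of the distributional
       equation. *)
    set (N := fun x => u x * Derive phi x
      - (Derive u x + c * u x) * phi x).
    replace 0 with (N b - N a)
      by (unfold N; rewrite ha, hb', hda, hdb; ring).
    apply is_RInt_derive_piecewise.
    + intros x. unfold N. apply (continuous_minus (V := R_NormedModule));
        apply (continuous_mult (K := R_AbsRing)); auto.
      apply (continuous_plus (V := R_NormedModule)); auto.
      apply (continuous_scal_r (V := R_NormedModule)); auto.
    + apply piecewise_continuous_plus.
      * apply piecewise_continuous_of_continuous. intros x.
        apply (continuous_minus (V := R_NormedModule)).
        -- apply (continuous_mult (K := R_AbsRing)); auto.
        -- apply (continuous_scal_r (V := R_NormedModule)).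
           apply (continuous_mult (K := R_AbsRing)); auto.
      * apply piecewise_continuous_mult.
        -- apply reaction_piecewise_continuous; auto.
        -- apply piecewise_continuous_of_continuous, c0.
    + intros x hx. unfold N.
      assert (a1 := proj1 hs x). assert (a2 := hdd x hx).
      assert (a3 := d1 x). assert (a4 := d2 x).
      auto_derive; [ex_derives|].
      rewrite (is_derive_unique (fun t : R => u t) _ _ a1),
        (is_derive_unique (fun t : R => Derive u t) _ _ a2),
        (is_derive_unique (fun t : R => phi t) _ _ a3),
        (is_derive_unique (fun t : R => Derive phi t) _ _ a4).
      ring.
Qed.

Theorem theorem1p4 (mu : R -> R) (hmu : is_step mu) :
  (forall c : R, 0 <= c < 2 ->
     exists theta : R -> R,
       unique (front mu c) theta /\
       exp_rate_m_infty theta 1 /\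
       exp_rate_p_infty theta 0 /\
       (forall x : R, 0 < theta x) /\
       (forall x : R, Derive theta x < 0)) /\
  (forall c : R, 2 < c -> ~ exists theta : R -> R, front mu c theta).
Proof.
  split.
  - intros c hc. assert (hc0 : 0 <= c) by lra.
    destruct (classical_front_exists c hc) as [u [du [M [hu hM]]]].
    exists u. split; [split|split; [|split; [|split]]].
    + exact (front_of_classical mu c M u du hmu hc0 hu hM).
    + intros u' hu'.
      exact (classical_front_unique c u du u' (Derive u') hc0 hu
        (classical_of_front mu c u' hmu hu')).
    + exact (classical_front_rate_m_infty c u du hc0 hu).
    + exact (classical_front_rate_p_infty c u du hc0 hu).
    + intros x. apply hu.
    + intros x. rewrite (is_derive_unique _ _ _ (front_derive c u du hu x)).
      exact (du_neg c u du hc0 hu x).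
  - intros c hc [u hu].
    destruct (front_derive_bounded mu c u hu) as [M hM].
    pose proof (classical_front_speed c u (Derive u) ltac:(lra)
      (classical_of_front mu c u hmu hu) M hM). lra.
Qed.
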